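(* Let $I$ be an interval of $\mathbb R$ of length $1$, $m$ the Lebesgue measure on it, and $\mathcal P$ a $(\lambda_1,\lambda_2)$-good grid of $I$ all of whose elements are intervals. Let $p\in[1,\infty)$. If $0<s\le\beta\le\frac1p$, then there is $c_1>0$ such that for every $Q\in\mathcal P$ $$c_1\,\mathcal A^{bv}_{s,\beta,p}(Q)\subset\mathcal A^{bs}_{s,\beta,p,\infty}(Q).$$ If $0<s\le\beta<\tilde\beta\le\frac1p$, then for every $q\in[1,\infty]$ there is $c_2>0$ such that for every $Q\in\mathcal P$ $$c_2\,\mathcal A^{bv}_{s,\tilde\beta,p}(Q)\subset\mathcal A^{bs}_{s,\beta,p,q}(Q).$$ In particular, for every $q\in[1,\infty]$, $$\mathcal B^s_{p,q}=\mathcal B^s_{p,q}(\mathcal A^{bv}_{s,\beta,p})=\mathcal B^s_{p,q}(\mathcal A^{bv}_{s,\tilde\beta,p})$$ and the corresponding norms are equivalent.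
   Context: $|J|=m(J)$; $|\cdot|_p$ is the $L^p(I,m)$ norm; $\mathbb N=\{0,1,\dots\}$; sup modifications when an exponent is $\infty$; $cX=\{c\phi:\phi\in X\}$. Good grid ($0<\lambda_1<\lambda_2<1$): a sequence $\mathcal P=(\mathcal P^k)_{k\in\mathbb N}$ of finite families of measurable sets of positive measure with: $\mathcal P^0=\{I\}$; $I=\bigcup_{Q\in\mathcal P^k}Q$ up to a null set; the elements of $\mathcal P^k$ are pairwise disjoint; every $Q\in\mathcal P^k$, $k>0$, is contained in some $P\in\mathcal P^{k-1}$; $\lambda_1\le|Q|/|P|\le\lambda_2$ whenever $Q\subset P$, $Q\in\mathcal P^{k+1}$, $P\in\mathcal P^k$; $\bigcup_k\mathcal P^k$ generates the $\sigma$-algebra. Also $\mathcal P$ denotes $\bigcup_k\mathcal P^k$. Given sets $\mathcal A(Q)$, $Q\in\mathcal P$, of functions (''atoms'') vanishing outside $Q$, $\mathcal B^s_{p,q}(\mathcal A)=\mathcal B^s_{p,q}(I,\mathcal P,\mathcal A)$ is the set of complex $g\in L^p$ with $g=\sum_k\sum_{Q\in\mathcal P^k}s_Qa_Q$, $a_Q\in\mathcal A(Q)$, $s_Q\in\mathbb C$, $\sum_k|\sum_{Q\in\mathcal P^k}s_Qa_Q|_p<\infty$, and finite cost $(\sum_k(\sum_{Q\in\mathcal P^k}|s_Q|^p)^{q/p})^{1/q}$; $|g|_{\mathcal B^s_{p,q}(\mathcal A)}$ is the infimum of the costs. $\mathcal A^{sz}_{s,p}(Q)$, the $(s,p)$-Souza's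 atoms on $Q$: functions constant on $Q$, zero outside $Q$, with sup norm $\le|Q|^{s-1/p}$. $\mathcal B^s_{p,q}:=\mathcal B^s_{p,q}(\mathcal A^{sz}_{s,p})$. Bounded variation atoms (for $s\le\beta$): $\mathcal A^{bv}_{s,\beta,p}(Q)$ is the set of $a:\mathbb R\to\mathbb C$ vanishing outside $Q$ with $|a|_\infty\le|Q|^{s-1/p}$ and $var_{1/\beta}(a,Q)\le|Q|^{s-1/p}$, where $var_{1/\beta}(a,Q)=\sup(\sum_i|a(x_{i+1})-a(x_i)|^{1/\beta})^\beta$, the supremum over all finite sequences $x_1<x_2<\dots<x_n$ in the interior of $Q$. Besov's atoms: for $Q\in\mathcal P^{k_0}$ let $\mathcal P_Q^i=\{P\in\mathcal P^{k_0+i}:P\subset Q\}$, $\mathcal P_Q=(\mathcal P_Q^i)_{i\ge0}$, and let $\mathcal B^\beta_{p,\tilde q}(Q,\mathcal P_Q,\mathcal A^{sz}_{\beta,p})$ be the set of complex $g\in L^p$ vanishing outside $Q$ that can be written $g=\sum_{i\ge0}\sum_{P\in\mathcal P_Q^i}s_Pa_P$ with $s_P\in\mathbb C$, $a_P\in\mathcal A^{sz}_{\beta,p}(P)$ (i.e. $a_P$ is constant on $P$, zero outside $P$, with sup norm $\le|P|^{\beta-1/p}$), $\sum_i|\sum_{P\in\mathcal P_Q^i}s_Pa_P|_p<\infty$, and finite cost $(\sum_i(\sum_{P\in\mathcal P_Q^i}|s_P|^p)^{\tilde q/p})^{1/\tilde q}$; the norm of $g$ in this space is the infimum of these costs over all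 such representations. For $\tilde q\in[1,\infty]$, $\mathcal A^{bs}_{s,\beta,p,\tilde q}(Q)$ is the set of $a\in\mathcal B^\beta_{p,\tilde q}(Q,\mathcal P_Q,\mathcal A^{sz}_{\beta,p})$, zero outside $Q$, whose norm in that space is at most $|Q|^{s-\beta}/C_b$, where $C_b=(\sum_{k\ge0}\lambda_2^{k\beta\tilde q})^{1/\tilde q}$ ($=1$ if $\tilde q=\infty$).
   Formalization: The equality of B^s_{p,q} with B^s_{p,q}(A^bv_{s,β,p}) and the norm equivalence are stated for 0<s<β≤1/p, not for s=β, where they fail: on the dyadic grid of [0,1) take ∑2^{-ks}cos(2π2^k x) if q<∞, and ∑(k+1)2^{-ks}cos(2π2^k x) if q=∞. *)

(* Defs.v *)
From HB Require Import structures.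
From mathcomp Require Import all_boot all_order all_algebra.
From mathcomp Require Import all_classical all_reals all_analysis.
From mathcomp Require Import complex.
Set Implicit Arguments.
Unset Strict Implicit.
Unset Printing Implicit Defensive.
Import Order.TTheory GRing.Theory Num.Theory.
Import numFieldNormedType.Exports.
Local Open Scope classical_set_scope.
Local Open Scope ring_scope.
Local Open Scope complex_scope.

(* The real-valued modulus; [`|z|] would be an element of [R[i]]. *)
Definition cabs (R : realType) (z : R[i]) : R := Normc.normc z.

Section general_space.
Context d (T : measurableType d) (R : realType).
Variable m : {measure set T -> \bar R}.

Definition msize (Q : set T) : R := fine (m Q).

Definition cLnorm (p : \bar R) (f : T -> R[i]) : \bar R :=
  Lnorm m p (fun x => (cabs (f x))%:E).

Definition cLp (p : \bar R) : set (T -> R[i]) :=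
  [set f | [/\ measurable_fun setT (fun x => complex.Re (f x)),
               measurable_fun setT (fun x => complex.Im (f x)) &
               (cLnorm p f < +oo)%E]].

(* The sigma-algebra of the space [I] is the trace of the one of [T]; the
   grid generates it exactly, not merely up to null sets. *)
Record good_grid (I : set T) (l1 l2 : R) (P : nat -> set (set T)) : Prop :=
  GoodGrid {
    grid_l1_gt0 : 0 < l1;
    grid_l1_l2 : l1 < l2;
    grid_l2_lt1 : l2 < 1;
    grid_finite : forall k, finite_set (P k);
    grid_measurable : forall k Q, P k Q -> measurable Q;
    grid_pos : forall k Q, P k Q -> (0 < m Q)%E;
    grid_top : P 0%N = [set I];
    grid_cover : forall k, m.-negligible (I `+` \bigcup_(Q in P k) Q);
    grid_disjoint : forall k, trivIset (P k) id;
    grid_nested : forall k Q, P k.+1 Q -> exists2 Q', P k Q' & Q `<=` Q';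
    grid_ratio : forall k Q Q', P k.+1 Q -> P k Q' -> Q `<=` Q' ->
      l1 <= msize Q / msize Q' <= l2;
    grid_generates : <<s I, \bigcup_k P k >> =
                     [set A | measurable A /\ A `<=` I] }.

(* [P_Q], for [Q] in [P k0]. *)
Definition subgrid (P : nat -> set (set T)) (k0 : nat) (Q : set T) :
    nat -> set (set T) :=
  fun i => [set Q' | P (k0 + i)%N Q' /\ Q' `<=` Q].

(* The elements of a good grid determine their level, so coefficients and
   atoms are indexed by the element alone. *)
Definition layer (P : nat -> set (set T)) (c : set T -> R[i])
    (a : set T -> T -> R[i]) (k : nat) : T -> R[i] :=
  fun x => \sum_(Q \in P k) c Q * a Q x.

Definition is_rep (P : nat -> set (set T)) (A : set T -> set (T -> R[i]))
    (p : R) (g : T -> R[i]) (c : set T -> R[i]) (a : set T -> T -> R[i]) :=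
  [/\ forall k Q, P k Q -> A Q (a Q),
      (\sum_(0 <= k <oo) cLnorm p%:E (layer P c a k) < +oo)%E &
      cLnorm p%:E (fun x => g x - \sum_(0 <= k < n) layer P c a k x)
        @[n --> \oo] --> 0%E].

Definition rep_cost (P : nat -> set (set T)) (p : R) (q : \bar R)
    (c : set T -> R[i]) : \bar R :=
  match q with
  | r%:E => ((\sum_(0 <= k <oo)
      ((\sum_(Q \in P k) cabs (c Q) `^ p) `^ (r / p))%:E) `^ r^-1)%E
  | +oo%E => ereal_sup
      (range (fun k => ((\sum_(Q \in P k) cabs (c Q) `^ p) `^ p^-1)%:E))
  | -oo%E => 0%E (* junk: exponents are at least 1 *)
  end.

(* The smoothness parameter only enters through the atoms [A]. *)
Definition besov (P : nat -> set (set T)) (A : set T -> set (T -> R[i]))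
    (p : R) (q : \bar R) : set (T -> R[i]) :=
  [set g | cLp p%:E g /\
    exists c a, is_rep P A p g c a /\ (rep_cost P p q c < +oo)%E].

Definition besov_norm (P : nat -> set (set T))
    (A : set T -> set (T -> R[i])) (p : R) (q : \bar R) (g : T -> R[i]) :
    \bar R :=
  ereal_inf [set t | exists c a, [/\ is_rep P A p g c a,
    (rep_cost P p q c < +oo)%E & t = rep_cost P p q c]].

(* Equality of the two spaces together with equivalence of their norms. *)
Definition besov_equiv (P : nat -> set (set T))
    (A A' : set T -> set (T -> R[i])) (p : R) (q : \bar R) :=
  besov P A p q = besov P A' p q /\
  exists C1 C2 : R, [/\ 0 < C1, 0 < C2 &
    forall g, besov P A p q g ->
      (C1%:E * besov_norm P A p q g <= besov_norm P A' p q g /\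
       besov_norm P A' p q g <= C2%:E * besov_norm P A p q g)%E].

Definition vanishes_outside (Q : set T) (a : T -> R[i]) :=
  forall x, ~ Q x -> a x = 0.

Definition souza_atom (s p : R) (Q : set T) : set (T -> R[i]) :=
  [set a | [/\ exists z, forall x, Q x -> a x = z,
               vanishes_outside Q a &
               forall x, cabs (a x) <= msize Q `^ (s - p^-1)]].

Definition besov_Cb (l2 b : R) (q : \bar R) : R :=
  match q with
  | r%:E => (limn (series (fun k : nat => l2 `^ (k%:R * b * r)))) `^ r^-1
  | _ => 1
  end.

Definition besov_atom (P : nat -> set (set T)) (l2 s b p : R) (q : \bar R)
    (k0 : nat) (Q : set T) : set (T -> R[i]) :=
  [set a | [/\ besov (subgrid P k0 Q) (souza_atom b p) p q a,
               vanishes_outside Q a &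
               (besov_norm (subgrid P k0 Q) (souza_atom b p) p q a <=
                 (msize Q `^ (s - b) / besov_Cb l2 b q)%:E)%E]].

End general_space.

Section real_line.
Variable R : realType.

(* [pvar b a Q] is [var_(1/b)(a, Q)]. *)
Definition pvar (b : R) (a : R -> R[i]) (Q : set R) : \bar R :=
  ereal_sup [set t | exists xs : seq R,
    [/\ sorted <%R xs, forall x, x \in xs -> interior Q x &
        t = ((\sum_(0 <= i < (size xs).-1)
               cabs (a xs`_i.+1 - a xs`_i) `^ b^-1) `^ b)%:E]].

Definition bv_atom (m : {measure set (measurableTypeR R) -> \bar R})
    (s b p : R) (Q : set R) : set (R -> R[i]) :=
  [set a | [/\ vanishes_outside (Q : set (measurableTypeR R)) a,
               (cLnorm m +oo a <= (msize m Q `^ (s - p^-1))%:E)%E &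
               (pvar b a Q <= (msize m Q `^ (s - p^-1))%:E)%E]].

Definition scale_set (c : R) (X : set (R -> R[i])) : set (R -> R[i]) :=
  [set (fun x => c%:C * f x) | f in X].

(* Lebesgue measure on [J], seen as the restriction to [J] of the Lebesgue
   measure of the line, so that functions on [J] are represented by functions
   on the line whose values outside [J] do not matter. *)
Definition leb_on (J : interval R) :
    {measure set (measurableTypeR R) -> \bar R} :=
  mrestr (@lebesgue_measure R) (measurable_itv J).

End real_line.

(* Main.v *)
(* A function a of bounded 1/b-variation on the interior of Q comes with a
   monotone function U satisfying |a x - a y|^(1/b) <= |U x - U y|.  The
   oscillations of U on disjoint cells add up to at most the variation of a,
   and this is all that is used about a.

   Given an atomic decomposition with partial sums S_n, let the n-th new layer
   be the step function which takes on each cell W of level n the increment of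
   the sampled values S_n (pt W), as compared with the parent of W; these
   layers telescope.  A bv atom on a cell Q of level k contributes to the
   coefficients of level j an l^p mass of order mu^(j-k), mu = l2^(b-s), by the
   interpolation inequality x^(1-u) y^u <= x + y applied to |W| / |Q| and to
   the normalized oscillation, with u = bp.  Hence the new level norms are
   dominated by the convolution of the old ones with a geometric sequence,
   which is bounded on l^q when s < b.  A single atom decomposes over the
   subgrid of its cell in the same way; then the case s = b is also allowed,
   since only one level is occupied. *)
Require Import Defs.
From HB Require Import structures.
From mathcomp Require Import all_boot all_order all_algebra.
From mathcomp Require Import all_classical all_reals all_analysis.
From mathcomp Require Import measurable_realfun ess_sup_inf.
From mathcomp Require Import complex ring lra.
Set Implicit Arguments.
Unset Strict Implicit.
Unset Printing Implicit Defensive.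
Import Order.TTheory GRing.Theory Num.Theory.
Import numFieldNormedType.Exports.
Local Open Scope classical_set_scope.
Local Open Scope ring_scope.

(** * Moduli and power inequalities *)

(** A function of the space is only an L^p limit and has no values at points, and expanding each
    atom separately would leave a double series over old and new cells to be rearranged. Sampling
    the finite sums S_n avoids both problems: S_n and the step function that samples it on level n
    differ in L^p by at most l2^(sn) times a constant and the convolution. Since s > 0, this tends
    to 0 as soon as the convolution is bounded.

    The new coefficient at a cell W compares two points of the parent of W, so oscillations are
    taken on parents, each of them repeated once per child. A cell has at most 1/l1 children, whence
    the constant 3 + 1/l1.

    The variation of an atom is measured in the interior of its cell and its supremum is an
    essential one. So sample points lie in interiors, and the ends of the cells are discarded as
    null sets. The exponent u = bp is admissible for interpolation because b <= 1/p. *)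

Section cabs_theory.
Variable R : realType.
Implicit Types x y z : R[i].

Lemma cabs_ge0 z : 0 <= cabs z.
Proof. by case: z => a b; exact: sqrtr_ge0. Qed.

Lemma cabs0 : cabs (0 : R[i]) = 0.
Proof. exact: Normc.normc0. Qed.

Lemma cabsM x y : cabs (x * y) = cabs x * cabs y.
Proof. exact: Normc.normcM. Qed.

Lemma cabsN x : cabs (- x) = cabs x.
Proof. by rewrite /cabs normcN. Qed.

Lemma cabsD x y : cabs (x + y) <= cabs x + cabs y.
Proof. exact: le_normcD. Qed.

Lemma cabs_sum I (r : seq I) (F : I -> R[i]) :
  cabs (\sum_(i <- r) F i) <= \sum_(i <- r) cabs (F i).
Proof.
elim/big_ind2 : _ => // [|x y u v xy uv]; first by rewrite cabs0.
by rewrite (le_trans (cabsD _ _))// lerD.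
Qed.

Lemma cabs_real (r : R) : cabs (r%:C)%C = `|r|.
Proof. by rewrite /cabs /= expr0n addr0 sqrtr_sqr. Qed.

Lemma Re_le_cabs z : `|complex.Re z| <= cabs z.
Proof.
case: z => a b /=; rewrite -sqrtr_sqr.
by rewrite ler_sqrt ?lerDl ?sqr_ge0 // addr_ge0 ?sqr_ge0.
Qed.

Lemma Im_le_cabs z : `|complex.Im z| <= cabs z.
Proof.
case: z => a b /=; rewrite -sqrtr_sqr.
by rewrite ler_sqrt ?lerDr ?sqr_ge0 // addr_ge0 ?sqr_ge0.
Qed.

End cabs_theory.

Section power_inequalities.
Variable R : realType.
Implicit Types p q x y : R.

Lemma ler_powR2l p x y : 0 <= p -> 0 <= x -> x <= y -> x `^ p <= y `^ p.
Proof.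
by move=> p0 x0 xy; rewrite ge0_ler_powR// nnegrE// (le_trans x0).
Qed.

Lemma ler_powR_root p x y : 0 < p -> 0 <= x -> 0 <= y ->
  x `^ p <= y `^ p -> x <= y.
Proof.
move=> p0 x0 y0 xy; rewrite leNgt; apply/negP => yx.
by move: xy; rewrite leNgt gt0_ltr_powR// nnegrE.
Qed.

Lemma powR_rootK p x : p != 0 -> 0 <= x -> (x `^ p^-1) `^ p = x.
Proof. by move=> p0 x0; rewrite -powRrM mulVf// powRr1. Qed.

Lemma powR_Kroot p x : p != 0 -> 0 <= x -> (x `^ p) `^ p^-1 = x.
Proof. by move=> p0 x0; rewrite -powRrM mulfV// powRr1. Qed.

Lemma powR_lt1 x r : 0 < x < 1 -> 0 < r -> x `^ r < 1.
Proof.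
move=> /andP[x0 x1] r0; have := @gt0_ltr_powR R r r0 x 1.
by rewrite !nnegrE powR1; apply => //; exact: ltW.
Qed.

Lemma powR_exprn x r n : 0 <= x -> (x ^+ n) `^ r = (x `^ r) ^+ n.
Proof. by move=> x0; rewrite -powR_mulrn// powRAC powR_mulrn// powR_ge0. Qed.

(* A version of Young's inequality with a worse constant; it replaces Hoelder's
   inequality in the estimates below. *)
Lemma powR_interp x y (u : R) : 0 <= x -> 0 <= y -> 0 <= u <= 1 ->
  x `^ (1 - u) * y `^ u <= x + y.
Proof.
move=> x0 y0 /andP[u0 u1]; have u1' : 0 <= 1 - u by rewrite subr_ge0.
have H z : 0 <= z -> z `^ (1 - u) * z `^ u = z.
  by move=> z0; rewrite -powRD ?subrK ?powRr1 ?oner_eq0.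
case: (leP x y) => [xy|/ltW yx].
  rewrite (@le_trans _ _ (y `^ (1 - u) * y `^ u))//.
    by rewrite ler_wpM2r ?powR_ge0// ler_powR2l.
  by rewrite H// lerDr.
rewrite (@le_trans _ _ (x `^ (1 - u) * x `^ u))//.
  by rewrite ler_wpM2l ?powR_ge0// ler_powR2l.
by rewrite H// lerDl.
Qed.

Lemma powR_convex p t x y : 1 <= p -> 0 <= t <= 1 -> 0 <= x -> 0 <= y ->
  (t * x + (1 - t) * y) `^ p <= t * x `^ p + (1 - t) * y `^ p.
Proof.
move=> p1 /andP[t0 t1] x0 y0.
have tb : (0 <= t <= 1)%R by rewrite t0 t1.
have := @convex_powR R p p1 (Itv01 t0 t1) x y.
rewrite !inE /= !in_itv /= !andbT => /(_ x0 y0).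
by rewrite !convRE /=.
Qed.

(** The weights are not normalized, whence the factor with exponent [p - 1]. The induction replaces
    the tail by one point [S / W] of weight [W] and applies two-point convexity. The first conjunct
    of the strengthened claim keeps [W * (S / W) = S] true when [W = 0]. *)
Lemma jensen_powR I (r : seq I) p (w x : I -> R) : 1 <= p ->
  (forall i, 0 <= w i) -> (forall i, 0 <= x i) ->
  (\sum_(i <- r) w i * x i) `^ p <=
  (\sum_(i <- r) w i) `^ (p - 1) * \sum_(i <- r) w i * x i `^ p.
Proof.
move=> p1 w0 x0; have p0 : 0 < p by rewrite (lt_le_trans _ p1).
suff [] : (\sum_(i <- r) w i = 0 -> \sum_(i <- r) w i * x i = 0) /\
  (\sum_(i <- r) w i * x i) `^ p <=
  (\sum_(i <- r) w i) `^ (p - 1) * \sum_(i <- r) w i * x i `^ p by [].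
elim: r => [|i r [IW IH]].
  by rewrite !big_nil mulr0 powR0// gt_eqF.
rewrite !big_cons.
set S := \sum_(i <- r) w i * x i in IH IW *.
set W := \sum_(i <- r) w i in IH IW *.
set X := \sum_(i <- r) _ in IH *.
have W0 : 0 <= W by apply: sumr_ge0.
have S0 : 0 <= S by apply: sumr_ge0 => j _; rewrite mulr_ge0.
have X0 : 0 <= X by apply: sumr_ge0 => j _; rewrite mulr_ge0// powR_ge0.
have [V0|V0] := eqVneq (w i + W) 0.
  have /andP[/eqP wi0 /eqP W00] : (w i == 0) && (W == 0).
    by rewrite -paddr_eq0// V0.
  by rewrite wi0 !mul0r !add0r; split.
split=> [/eqP|]; first by rewrite (negPf V0).
have VV : 0 < w i + W by rewrite lt_neqAle eq_sym V0 addr_ge0.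
have WS : W * (S / W) = S.
  have [WE|WN] := eqVneq W 0; last by rewrite mulrCA divff// mulr1.
  by rewrite WE mul0r IW.
have WSX : W * (S / W) `^ p <= X.
  have [WE|WN] := eqVneq W 0; first by rewrite WE mul0r.
  have Wp : 0 < W by rewrite lt_neqAle eq_sym WN.
  rewrite powRM ?invr_ge0// mulrCA -[leRHS]mul1r.
  rewrite -(@powR_inv1 _ W)// -powRrM mulN1r.
  have -> : W * W `^ (- p) = (W `^ (p - 1))^-1.
    rewrite -powRN -{1}(powRr1 W0) -powRD; last by rewrite WN implybT.
    by congr (_ `^ _); ring.
  rewrite mul1r ler_pdivrMr ?powR_gt0// mulrC.
  exact: IH.
have E : w i * x i + S = (w i + W) *
   (w i / (w i + W) * x i + (1 - w i / (w i + W)) * (S / W)).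
  by rewrite -[in LHS]WS; move: (S / W) => y; field.
have t01 : 0 <= w i / (w i + W) <= 1.
  by rewrite divr_ge0 ?addr_ge0//= ler_pdivrMr// mul1r lerDl.
have [_ t1] := andP t01.
rewrite E powRM; first last.
- have [t0 _] := andP t01; apply: addr_ge0; apply: mulr_ge0 => //.
    by rewrite subr_ge0.
  exact: divr_ge0.
- exact: ltW.
rewrite -[(w i + W) `^ p]mulr_powRB1 ?(ltW VV)// mulrAC mulrC.
rewrite ler_wpM2l ?powR_ge0//.
rewrite -ler_pdivlMl//.
apply: (le_trans (powR_convex p1 t01 _ _)) => //; first by rewrite divr_ge0.
rewrite ler_pdivlMl// mulrDr !mulrA.
have -> : (w i + W) * (1 - w i / (w i + W)) = W by field.
have -> : (w i + W) * w i / (w i + W) = w i by field.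
by rewrite lerD2l.
Qed.

Lemma minkowski_sum (I K : eqType) (r : seq I) (s : seq K) p
    (f : K -> I -> R) (A : K -> R) : 1 <= p ->
  (forall k i, 0 <= f k i) -> (forall k, 0 <= A k) ->
  (forall k, k \in s -> \sum_(i <- r) f k i `^ p <= A k `^ p) ->
  \sum_(i <- r) (\sum_(k <- s) f k i) `^ p <= (\sum_(k <- s) A k) `^ p.
Proof.
move=> p1 f0 A0 fA; have p0 : 0 < p by rewrite (lt_le_trans _ p1).
set B := \sum_(k <- s) A k.
have B0 : 0 <= B by apply: sumr_ge0.
(* When [A k = 0], the hypothesis forces [f k] to vanish on [r], so dividing by [A k] loses
   nothing. *)
have Af k i : k \in s -> i \in r -> A k * (f k i / A k) = f k i.
  move=> ks ir; have [Ak|Ak] := eqVneq (A k) 0; last by field.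
  rewrite Ak mul0r; have := fA _ ks.
  rewrite Ak powR0 ?gt_eqF// => h.
  have : \sum_(i <- r) f k i `^ p == 0.
    by rewrite eq_le h sumr_ge0// => j _; rewrite powR_ge0.
  rewrite psumr_eq0 => [/allP/(_ _ ir)/=|j _]; last exact: powR_ge0.
  by rewrite powR_eq0 => /andP[/eqP ->].
(* Jensen's inequality with the weights [A k] applied to [f k i / A k]. *)
apply: (@le_trans _ _ (\sum_(i <- r) B `^ (p - 1) *
    \sum_(k <- s) A k * (f k i / A k) `^ p)).
  rewrite big_seq [leRHS]big_seq; apply: ler_sum => i ir.
  rewrite (eq_big_seq (fun k => A k * (f k i / A k))) => [|k ks]; last first.
    by rewrite Af.
  by apply: jensen_powR => // k; rewrite divr_ge0.
rewrite -mulr_sumr exchange_big/=.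
rewrite -[leRHS]mulr_powRB1// [leRHS]mulrC ler_wpM2l ?powR_ge0//.
rewrite /B big_seq [leRHS]big_seq.
apply: ler_sum => k ks; rewrite -mulr_sumr.
have [->|Ak] := eqVneq (A k) 0; first by rewrite mul0r.
rewrite -[leRHS]mulr1 ler_wpM2l//.
under eq_bigr do rewrite powRM ?invr_ge0//.
rewrite -mulr_suml -(@powR_inv1 _ (A k))// -powRrM mulN1r powRN.
rewrite ler_pdivrMr ?mul1r ?fA// powR_gt0// lt_neqAle eq_sym Ak; exact: A0.
Qed.

(** * Convolution with a geometric sequence *)

Definition geom_conv (mu : R) (A : nat -> R) (j : nat) : R :=
  \sum_(0 <= k < j.+1) mu ^+ (j - k) * A k.

Lemma geom_convS mu A j :
  geom_conv mu A j.+1 = mu * geom_conv mu A j + A j.+1.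
Proof.
rewrite /geom_conv big_nat_recr//= subnn expr0 mul1r mulr_sumr; congr (_ + _).
rewrite !big_nat; apply: eq_bigr => k /andP[_ kj].
by rewrite subSn// exprS mulrA.
Qed.

Lemma geom_conv0 mu A : geom_conv mu A 0 = A 0%N.
Proof. by rewrite /geom_conv big_nat1 subnn expr0 mul1r. Qed.

Lemma geom_conv_ge0 mu A j : 0 <= mu -> (forall k, 0 <= A k) ->
  0 <= geom_conv mu A j.
Proof.
by move=> mu0 A0; apply: sumr_ge0 => k _; rewrite mulr_ge0// exprn_ge0.
Qed.

Lemma geom_conv_bound mu A B j : 0 <= mu < 1 -> (forall k, 0 <= A k <= B) ->
  (1 - mu) * geom_conv mu A j <= B.
Proof.
move=> /andP[mu0 mu1] AB; have B0 : 0 < 1 - mu by rewrite subr_gt0.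
elim: j => [|j IH].
  rewrite geom_conv0; have /andP[A0 A0B] := AB 0%N.
  by rewrite (le_trans _ A0B)// ler_piMl// lerBlDr lerDl.
rewrite geom_convS mulrDr mulrCA.
have /andP[A0 A0B] := AB j.+1.
rewrite -[leRHS](@subrK _ (mu * B)) addrC -[X in _ <= X - _ + _]mul1r -mulrBl.
by rewrite lerD// ler_wpM2l// ltW.
Qed.

(** With the factor [1 - mu] the convolution is an average: its value at [j.+1] is the convex
    combination, with weights [mu] and [1 - mu], of its value at [j] and of [A j.+1]. Convexity of
    the power then gives the l^q bound with constant one. *)
Lemma geom_conv_powR mu A q n : 0 <= mu < 1 -> 1 <= q ->
  (forall k, 0 <= A k) ->
  \sum_(0 <= j < n) ((1 - mu) * geom_conv mu A j) `^ q <=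
  \sum_(0 <= j < n) A j `^ q.
Proof.
move=> /andP[mu0 mu1] q1 A0; have m0 : 0 < 1 - mu by rewrite subr_gt0.
have q0 : 0 < q by rewrite (lt_le_trans _ q1).
case: n => [|n]; first by rewrite !big_nil.
pose y j := ((1 - mu) * geom_conv mu A j) `^ q.
have y0 j : 0 <= y j by exact: powR_ge0.
rewrite -(ler_pM2l m0).
(* The extra summand [mu * y n] is what the next convexity step consumes; with it the induction
   closes. *)
apply: (@le_trans _ _
  ((1 - mu) * \sum_(0 <= j < n.+1) y j + mu * y n)).
  by rewrite lerDl mulr_ge0.
elim: n => [|n IH].
  rewrite !big_nat1 -mulrDl subrK mul1r /y geom_conv0.
  have := @powR_convex q (1 - mu) (A 0%N) 0 q1.
  rewrite mulr0 addr0 powR0 ?gt_eqF// mulr0 addr0; apply => //.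
  by rewrite ltW//= lerBlDr lerDl.
rewrite big_nat_recr//= [in leRHS]big_nat_recr//= !mulrDr -addrA -mulrDl.
rewrite subrK mul1r.
apply: (@le_trans _ _ ((1 - mu) * \sum_(0 <= j < n.+1) y j +
   (mu * y n + (1 - mu) * A n.+1 `^ q))); last by rewrite addrA lerD2r.
rewrite lerD2l /y geom_convS mulrDr mulrCA.
apply: powR_convex => //; first by rewrite mu0 ltW.
by apply: mulr_ge0; [exact: ltW|exact: geom_conv_ge0].
Qed.

End power_inequalities.

(** * Functions of bounded variation *)

Section variation.
Variable R : realType.
Implicit Types (a : R -> R[i]) (Q : set R) (b V : R).

Definition var_sum b a (xs : seq R) : R :=
  \sum_(0 <= i < (size xs).-1) cabs (a xs`_i.+1 - a xs`_i) `^ b^-1.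

(** The outer power [b] of [pvar] is left out: the sums of [b^-1]-th powers add up along consecutive
    pieces of a chain, their [b]-th powers do not. *)
Definition var_bounded b a Q V := forall xs, sorted <%R xs ->
  (forall x, x \in xs -> interior Q x) -> var_sum b a xs <= V.

Lemma var_sum_ge0 b a xs : 0 <= var_sum b a xs.
Proof. by apply: sumr_ge0 => i _; exact: powR_ge0. Qed.

Lemma var_sum_rcons b a c s x : var_sum b a (rcons (c :: s) x) =
  var_sum b a (c :: s) + cabs (a x - a (last c s)) `^ b^-1.
Proof.
rewrite /var_sum size_rcons/= big_nat_recr//=; congr (_ + _).
  rewrite !big_nat; apply: eq_bigr => i /andP[_ si].
  rewrite nth_rcons si -rcons_cons nth_rcons /=.
  by rewrite (ltn_trans si).
by rewrite nth_rcons ltnn eqxx -rcons_cons nth_rcons/= ltnSn (last_nth 0).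
Qed.

Lemma variation_function b a Q V : b != 0 -> var_bounded b a Q V ->
  exists U : R -> R, [/\ nondecreasing_fun U, forall x, 0 <= U x <= V &
    forall x y, interior Q x -> interior Q y ->
      cabs (a x - a y) `^ b^-1 <= `|U x - U y|].
Proof.
move=> b0 aV.
pose S x := [set var_sum b a xs | xs in [set xs | [/\ sorted <%R xs,
  forall y, y \in xs -> interior Q y & forall y, y \in xs -> y <= x]]].
have S0 x : S x 0 by exists [::] => //; rewrite /var_sum big_nil.
have Sub x : ubound (S x) V by move=> _ [xs [s1 s2 s3] <-]; exact: aV.
have hS x : has_sup (S x) by split; [exists 0|exists V; exact: Sub].
have U0 x : 0 <= sup (S x) by apply: ub_le_sup => //; exists V; exact: Sub.
have Umono : nondecreasing_fun (fun x => sup (S x)).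
  move=> x y xy; apply: ge_sup; first by exists 0.
  move=> _ [xs [s1 s2 s3] <-]; apply: ub_le_sup; first by exists V; exact: Sub.
  by exists xs => //; split=> // z /s3 zx; exact: le_trans xy.
have step x y : interior Q x -> interior Q y -> x < y ->
    cabs (a y - a x) `^ b^-1 <= sup (S y) - sup (S x).
  move=> Qx Qy xy; rewrite lerBrDl -lerBrDr; apply: ge_sup; first by exists 0.
  move=> _ [xs [s1 s2 s3] <-].
  (* Before [y] is appended the chain has to end at [x] itself. Adding [x] can only increase the
     sum, and the empty chain is replaced by the single point [x]. *)
  have [c [s [s1' s2' s3' lx le]]] : exists c s, [/\ sorted <%R (c :: s),
      forall z, z \in c :: s -> interior Q z,
      forall z, z \in c :: s -> z <= x, last c s = x &
      var_sum b a xs <= var_sum b a (c :: s)].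
    case: xs s1 s2 s3 => [|c s] s1 s2 s3.
      exists x, [::]; split => //; try by move=> z; rewrite inE => /eqP ->.
      by rewrite /var_sum !big_nil.
    have := s3 (last c s) (mem_last _ _); rewrite le_eqVlt => /predU1P[lx|lx].
      by exists c, s; split.
    exists c, (rcons s x); split.
    - by rewrite /= rcons_path lx andbT.
    - by move=> z; rewrite -rcons_cons mem_rcons inE => /predU1P[->//|/s2].
    - by move=> z; rewrite -rcons_cons mem_rcons inE => /predU1P[->//|/s3].
    - by rewrite last_rcons.
    - by rewrite -rcons_cons var_sum_rcons lerDl powR_ge0.
  rewrite lerBrDr (le_trans (lerD le (lexx _)))//.
  rewrite -lx -var_sum_rcons; apply: ub_le_sup; first by exists V; exact: Sub.
  exists (rcons (c :: s) y) => //; split.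
  - by rewrite /= rcons_path lx xy andbT.
  - by move=> z; rewrite mem_rcons inE => /predU1P[->//|/s2'].
  - move=> z; rewrite mem_rcons inE => /predU1P[->//|zs].
    by rewrite (le_trans (s3' _ zs))// ltW.
exists (fun x => sup (S x)); split => // [x|x y Qx Qy].
  by rewrite U0/=; apply: ge_sup; [exists 0|exact: Sub].
have [xy|yx|->] := ltgtP x y.
- rewrite -cabsN opprB distrC ger0_norm; first exact: step.
  by rewrite subr_ge0; apply/Umono/ltW.
- rewrite ger0_norm; first exact: step.
  by rewrite subr_ge0; apply/Umono/ltW.
- by rewrite !subrr cabs0 powR0 ?invr_eq0// normr0.
Qed.

(* Monotone functions are measurable, and [{f > r}] is the preimage under [U]
   of the union of the balls of radius [(f x - r)^(1/b)] about the points
   [U x] with [f x > r]. *)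
Lemma holder_monotone_measurable b (f U : R -> R) (D : set R) : 0 < b ->
  measurable D -> nondecreasing_fun U ->
  (forall x y, D x -> D y -> `|f x - f y| `^ b^-1 <= `|U x - U y|) ->
  measurable_fun D f.
Proof.
move=> b0 mD Umono fU.
move=> _; apply: (measurability (@measurable_realfun.RGenOInfty.G R)).
  exact: measurable_realfun.RGenOInfty.measurableE.
move=> _ [_ [r ->] <-].
pose O := \bigcup_(x in D `&` [set x | r < f x]) ball (U x) ((f x - r) `^ b^-1).
have -> : D `&` f @^-1` `]r, +oo[ = D `&` U @^-1` O.
  apply/seteqP; split => x [Dx] /=.
    rewrite in_itv/= andbT => rf; split=> //; exists x => //.
    by apply: ballxx; rewrite powR_gt0// subr_gt0.
  move=> [y [Dy /= ry]] yx; split => //=; rewrite in_itv/= andbT.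
  have : `|f y - f x| `^ b^-1 < (f y - r) `^ b^-1.
    exact: le_lt_trans (fU _ _ Dy Dx) yx.
  have ry' : 0 <= f y - r by rewrite subr_ge0 ltW.
  move=> h; have : `|f y - f x| < f y - r.
    rewrite ltNge; apply/negP => h'; move: h; rewrite ltNge; apply/negP/negPn.
    by rewrite ler_powR2l// invr_ge0 ltW.
  by move=> /(le_lt_trans (ler_norm _)); rewrite ltrD2l ltrN2.
apply: measurable_realfun.nondecreasing_measurable => //.
  by apply: open_measurable; apply: bigcup_open => x _; exact: ball_open.
exact: mD.
Qed.

(** The head interval separates the others into those on its left, inside [[lo, y i]], and those on
    its right, inside [[z i, hi]]; strong induction applies to both groups. Intervals may be single
    points, as oscillations may vanish. *)
Lemma sum_disjoint_lengths (I : eqType) (s : seq I) (y z : I -> R) lo hi :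
  uniq s -> lo <= hi ->
  (forall i, i \in s -> [/\ lo <= y i, y i <= z i & z i <= hi]) ->
  {in s &, forall i j, i != j -> z i <= y j \/ z j <= y i} ->
  \sum_(i <- s) (z i - y i) <= hi - lo.
Proof.
have [n] := ubnP (size s); elim: n s lo hi => // n IH [|i s] lo hi /=.
  by move=> _ _ lohi _ _; rewrite big_nil subr_ge0.
rewrite ltnS => sn /andP[iNs us] lohi yz dis.
have [ly yzi zh] := yz i (mem_head _ _).
rewrite big_cons (bigID (fun j => z j <= y i))/=.
have left_le : \sum_(j <- s | z j <= y i) (z j - y j) <= y i - lo.
  rewrite -big_filter; apply: IH => //.
  - by rewrite (leq_ltn_trans _ sn)// size_filter count_size.
  - by rewrite filter_uniq.
  - move=> j; rewrite mem_filter => /andP[zy js].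
    by have [] := yz j (mem_behead (s := i :: s) js).
  - move=> j k; rewrite !mem_filter => /andP[_ js] /andP[_ ks].
    by apply: dis; rewrite inE ?js ?ks orbT.
have right_le : \sum_(j <- s | ~~ (z j <= y i)) (z j - y j) <= hi - z i.
  rewrite -big_filter; apply: IH => //.
  - by rewrite (leq_ltn_trans _ sn)// size_filter count_size.
  - by rewrite filter_uniq.
  - move=> j; rewrite mem_filter => /andP[zy js].
    have [? ? ?] := yz j (mem_behead (s := i :: s) js); split=> //.
    have ij : i != j by apply: contraNneq iNs => ->.
    have := dis i j; rewrite mem_head inE js orbT => /(_ isT isT ij).
    by rewrite (negPf zy); case.
  - move=> j k; rewrite !mem_filter => /andP[_ js] /andP[_ ks].
    by apply: dis; rewrite inE ?js ?ks orbT.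
by move: left_le right_le; lra.
Qed.

(** * Oscillations of a monotone function on disjoint intervals *)

Definition osc (U : R -> R) (W : set R) : R := sup (U @` W) - inf (U @` W).

Section osc_theory.
Variables (U : R -> R) (V : R).
Hypotheses (Umono : nondecreasing_fun U) (UV : forall x, 0 <= U x <= V).

Let has_supU W : W !=set0 -> has_sup (U @` W).
Proof.
move=> [x Wx]; split; first by exists (U x), x.
by exists V => _ [z _ <-]; have /andP[] := UV z.
Qed.

Let has_infU W : W !=set0 -> has_inf (U @` W).
Proof.
move=> [x Wx]; split; first by exists (U x), x.
by exists 0 => _ [z _ <-]; have /andP[] := UV z.
Qed.

Lemma le_osc W x y : W x -> W y -> `|U x - U y| <= osc U W.
Proof.
move=> Wx Wy; have W0 : W !=set0 by exists x.
have [_ hs] := has_supU W0; have [_ hi] := has_infU W0.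
have sW z : W z -> U z <= sup (U @` W).
  by move=> Wz; apply: ub_le_sup => //; exists z.
have iW z : W z -> inf (U @` W) <= U z.
  by move=> Wz; apply: ge_inf => //; exists z.
rewrite /osc ler_norml; have := sW _ Wx; have := iW _ Wx.
by have := sW _ Wy; have := iW _ Wy; lra.
Qed.

Lemma osc_ge0 W : 0 <= osc U W.
Proof.
have [->|/set0P[x Wx]] := eqVneq W set0.
  by rewrite /osc image_set0 sup0 inf0 subrr.
by have := le_osc Wx Wx; rewrite subrr normr0.
Qed.

(** A monotone [U] maps disjoint intervals to sets whose hulls meet at most in an end, whether [U]
    jumps or is constant in between, and these hulls all lie in [[0, V]]. *)
Lemma sum_osc (s : seq (set R)) : uniq s ->
  {in s, forall W, is_interval W /\ W !=set0} ->
  {in s &, forall W W', W != W' -> W `&` W' = set0} ->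
  \sum_(W <- s) osc U W <= V.
Proof.
move=> us sI sdis; rewrite -[leRHS]subr0.
have V0 : 0 <= V by have /andP[/le_trans h /h] := UV 0.
apply: sum_disjoint_lengths => // [W /sI[_ W0]|W W' sW sW' WW'].
  have [x Wx] := W0; have := osc_ge0 W; rewrite subr_ge0 => iU.
  have [_ hs] := has_supU W0; have [_ hi] := has_infU W0.
  split=> //.
    apply: lb_le_inf; first by exists (U x), x.
    by move=> _ [z _ <-]; have /andP[] := UV z.
  apply: ge_sup; first by exists (U x), x.
  by move=> _ [z _ <-]; have /andP[] := UV z.
have [iW [w Ww]] := sI _ sW; have [iW' [w' Ww']] := sI _ sW'.
have disj x : W x -> W' x -> False.
  by move=> Wx Wx'; have : (W `&` W') x by []; rewrite sdis.
have key (A B : set R) u v : is_interval A -> is_interval B ->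
    (forall x, A x -> B x -> False) -> A u -> B v -> u <= v ->
    sup (U @` A) <= inf (U @` B).
  move=> iA iB AB Aa Bb ab.
  have lt_AB x y : A x -> B y -> x <= y.
    move=> Ax By; rewrite leNgt; apply/negP => yx.
    have [xb|bx] := leP x v.
      by apply: (AB x) => //; apply: (iB y v) => //; rewrite (ltW yx).
    by apply: (AB v) => //; apply: (iA u x) => //; rewrite ab ltW.
  apply: ge_sup; first by exists (U u), u.
  move=> _ [x Ax <-]; apply: lb_le_inf; first by exists (U v), v.
  by move=> _ [y By <-]; apply/Umono/lt_AB.
have [ww'|/ltW w'w] := leP w w'.
  by left; apply: (key _ _ w w').
by right; apply: (key _ _ w' w) => // x /[swap]; exact: disj.
Qed.

End osc_theory.

Lemma interior_itv_oo (W : set R) x y z : is_interval W -> W y -> W z ->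
  y < x < z -> interior W x.
Proof.
move=> iW Wy Wz yxz; rewrite /interior.
have xI : x \in `]y, z[ by rewrite in_itv.
apply: filterS (near_in_itvoo xI) => t /=; rewrite in_itv/= => /andP[yt tz].
by apply: (iW y z) => //; rewrite !ltW.
Qed.

Lemma itv_setD_interior (W : set R) : is_interval W ->
  W `\` interior W `<=` [set inf W; sup W].
Proof.
move=> iW x [Wx Nx].
have [[y [Wy yx]]|noy] := pselect (exists y, W y /\ y < x); last first.
  have lbx : lbound W x.
    by move=> y Wy; rewrite leNgt; apply/negP => yx; apply: noy; exists y.
  left; apply/eqP; rewrite eq_le; apply/andP; split.
    by apply: lb_le_inf => //; exists x.
  by apply: ge_inf => //; exists x.
right; apply/eqP; rewrite eq_le.
have ubx : ubound W x.
  move=> z Wz; rewrite leNgt; apply/negP => xz; apply: Nx.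
  by apply: (interior_itv_oo iW Wy Wz); rewrite yx.
apply/andP; split.
  by apply: ub_le_sup => //; exists x.
by apply: ge_sup => //; exists x.
Qed.

(** [bv_atom] does not ask for measurability, while the L^p estimates do; it has to come from the
    variation. *)
Lemma var_bounded_measurable (b : R) a Q V : 0 < b -> is_interval Q ->
  (forall x, ~ Q x -> a x = 0) -> var_bounded b a Q V ->
  measurable_fun (setT : set (measurableTypeR R)) (fun x => complex.Re (a x)) /\
  measurable_fun (setT : set (measurableTypeR R)) (fun x => complex.Im (a x)).
Proof.
move=> b0 iQ a0 aV.
have [U [Umono UV aU]] := variation_function (lt0r_neq0 b0) aV.
have mi : measurable (interior Q : set (measurableTypeR R)).
  exact: open_measurable (open_interior _).
have mQ : measurable (Q : set (measurableTypeR R)).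
  exact: is_interval_measurable.
(* The variation says nothing about the two possible ends of [Q], so they are separated as single
   points; on the complement of [Q] the function is zero. *)
have Qsplit : [set: measurableTypeR R] = interior Q `|`
    ([set inf Q] `|` ([set sup Q] `|` ~` Q)).
  apply/seteqP; split => // x _; have [Qx|NQx] := pselect (Q x); last first.
    by right; right; right.
  have [iQx|NiQx] := pselect (interior Q x); first by left.
  by have [->|->] := itv_setD_interior iQ (conj Qx NiQx); right;
    [left|right; left].
have gen (f : R -> R) : (forall x, ~ Q x -> f x = 0) ->
    (forall x y, `|f x - f y| <= cabs (a x - a y)) ->
    measurable_fun (setT : set (measurableTypeR R)) f.
  move=> f0 fa; rewrite Qsplit.
  have m1 (r : R) : measurable ([set r] : set (measurableTypeR R)).
    exact: measurable_set1.
  have mC := measurableC mQ.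
  apply/measurable_funU => //; first by do 2?apply: measurableU.
  split.
    apply: (holder_monotone_measurable b0 _ Umono) => // x y Qx Qy.
    by apply: le_trans (aU _ _ Qx Qy); rewrite ler_powR2l// invr_ge0 ltW.
  apply/measurable_funU => //; first by apply: measurableU.
  split; first exact: measurable_fun_set1.
  apply/measurable_funU => //; split; first exact: measurable_fun_set1.
  have := @eq_measurable_fun _ _ (measurableTypeR R) (measurableTypeR R)
    (~` Q) (fun=> 0) f.
  by apply => [x|]; [rewrite inE => NQx; rewrite f0|exact: measurable_cst].
split; apply: gen => x; try by move=> /a0 ->.
  move=> y; apply: le_trans (Re_le_cabs _).
  by case: (a x) (a y) => [? ?] [? ?].
move=> y; apply: le_trans (Im_le_cabs _).
by case: (a x) (a y) => [? ?] [? ?].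
Qed.

End variation.

(** * Trees of intervals *)

Section grid_trees.
Variable R : realType.
Notation T := (measurableTypeR R).
Variable mu : {measure set T -> \bar R}.

(** The common form of the whole grid and of the subgrid below one cell, so that a single expansion
    theorem serves the spaces and the individual atoms. Points are null, which disposes of the ends
    of the cells. *)
Record grid_tree (l1 l2 : R) (F : nat -> set (set T)) (top : set T) : Prop :=
  GridTree {
    tree_pt : forall x : R, mu [set x] = 0;
    tree_le1 : (mu setT <= 1)%E;
    tree_l1_gt0 : 0 < l1;
    tree_l2_itv : 0 < l2 < 1;
    tree_finite : forall k, finite_set (F k);
    tree_measurable : forall k W, F k W -> measurable W;
    tree_itv : forall k W, F k W -> is_interval (W : set R);
    tree_pos : forall k W, F k W -> (0 < mu W)%E;
    tree_top : F 0%N = [set top];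
    tree_cover : forall k, mu.-negligible (top `\` \bigcup_(W in F k) W);
    tree_disjoint : forall k, trivIset (F k) id;
    tree_nested : forall k W, F k.+1 W -> exists2 W', F k W' & W `<=` W';
    tree_ratio : forall k W W', F k.+1 W -> F k W' -> W `<=` W' ->
      l1 <= msize mu W / msize mu W' <= l2 }.

Definition ancestor (F : nat -> set (set T)) k (W : set T) : set T :=
  xget set0 [set Q | F k Q /\ W `<=` Q].

(** Coefficients are indexed by cells alone, so the level is recovered from the cell; [level_unique]
    makes this meaningful. *)
Definition tree_level (F : nat -> set (set T)) (W : set T) : nat :=
  xget 0%N [set k | F k W].

Definition cells (F : nat -> set (set T)) (k : nat) : seq (set T) :=
  finmap.enum_fset (fset_set (F k)).

Definition level_norm (F : nat -> set (set T)) (p : R) (c : set T -> R[i])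
    (k : nat) : R :=
  (\sum_(Q <- cells F k) cabs (c Q) `^ p) `^ p^-1.

Lemma sum_fiber (I K : eqType) (r : seq I) (s : seq K) (f : I -> K)
    (h : I -> R) : uniq s -> {in r, forall i, f i \in s} ->
  \sum_(i <- r) h i = \sum_(k <- s) \sum_(i <- r | f i == k) h i.
Proof.
move=> us fs; under [RHS]eq_bigr do rewrite big_mkcond.
rewrite exchange_big/= big_seq [RHS]big_seq; apply: eq_bigr => i ir.
rewrite (bigD1_seq (f i))//= ?fs// eqxx big1 ?addr0// => k.
by rewrite eq_sym => /negPf ->.
Qed.

Section small_measure.
Hypothesis mu1 : (mu setT <= 1)%E.

Lemma msize_fin W : measurable W -> mu W = (msize mu W)%:E.
Proof.
move=> mW; rewrite /msize fineK// ge0_fin_numE//.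
rewrite (@le_lt_trans _ _ 1%E) ?ltry// (le_trans _ mu1)//.
by apply: le_measure; rewrite ?inE.
Qed.

Lemma msize_ge0 W : 0 <= msize mu W.
Proof. exact: fine_ge0. Qed.

Lemma le_msize W W' : measurable W -> measurable W' -> W `<=` W' ->
  msize mu W <= msize mu W'.
Proof.
move=> mW mW' WW'; rewrite -lee_fin -!msize_fin//.
by apply: le_measure; rewrite ?inE.
Qed.

Lemma sum_msize (s : seq (set T)) Q : uniq s -> measurable Q ->
  {in s, forall W, measurable W /\ W `<=` Q} ->
  {in s &, forall W W', W != W' -> W `&` W' = set0} ->
  \sum_(W <- s) msize mu W <= msize mu Q.
Proof.
move=> us mQ sQ sdis; rewrite -lee_fin -msize_fin//.
have := @measure_fin_bigcup _ _ _ mu _ [set` s] id (finite_seq s).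
rewrite -fsbig_seq// => H.
have -> : (\sum_(W <- s) msize mu W)%:E = (\sum_(W <- s) mu W)%E.
  rewrite -sumEFin big_seq [RHS]big_seq; apply: eq_bigr => W /sQ[mW _].
  by rewrite msize_fin.
rewrite -H; first last.
- by move=> W /= /sQ[].
- apply/trivIsetP => W W' /= sW sW' WW'; exact: sdis.
apply: le_measure; rewrite ?inE//.
  by apply: fin_bigcup_measurable => [|W /= /sQ[]]; first exact: finite_seq.
by move=> x [W /= /sQ[_ h]] /h.
Qed.

End small_measure.

Section tree_theory.
Variables (l1 l2 : R) (F : nat -> set (set T)) (top : set T).
Hypothesis tr : grid_tree l1 l2 F top.

Local Notation anc := (ancestor F).
Local Notation lvl := (tree_level F).
Local Notation sz := (msize mu).

Let mu1 := tree_le1 tr.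

Lemma negligible_pt (x : R) : mu.-negligible [set x].
Proof.
by exists [set x]; split; [exact: measurable_set1|exact: (tree_pt tr)|].
Qed.

Lemma mem_cells k W : (W \in cells F k) = `[< F k W >].
Proof.
rewrite /cells (in_fset_set (tree_finite tr k)).
by apply/idP/asboolP; rewrite inE.
Qed.

Lemma cellsP k W : reflect (F k W) (W \in cells F k).
Proof. by rewrite mem_cells; exact: asboolP. Qed.

Lemma cells_uniq k : uniq (cells F k).
Proof. exact: finmap.fset_uniq. Qed.

Lemma fsum_cells (V : nmodType) k (h : set T -> V) :
  \sum_(W \in F k) h W = \sum_(W <- cells F k) h W.
Proof. by rewrite fsbig_finite//; exact: (tree_finite tr k). Qed.

Lemma sz_gt0 k W : F k W -> 0 < sz W.
Proof.
move=> FW; rewrite -lte_fin -(msize_fin mu1); first exact: (tree_pos tr) FW.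
exact: (tree_measurable tr) FW.
Qed.

Lemma sz_le1 k W : F k W -> sz W <= 1.
Proof.
move=> /(tree_measurable tr) mW; rewrite -lee_fin -(msize_fin mu1)//.
by rewrite (le_trans _ mu1)//; apply: le_measure; rewrite ?inE.
Qed.

Lemma boundary_negligible k W : F k W ->
  mu.-negligible (W `\` interior (W : set R)).
Proof.
move=> FW.
have h := itv_setD_interior (tree_itv tr FW).
apply: (@negligibleS _ _ R mu _ _ h).
exact: negligibleU (negligible_pt _) (negligible_pt _).
Qed.

(** A cell has positive measure and only null ends. This provides the sample points. *)
Lemma interior_cell k W : F k W -> interior (W : set R) !=set0.
Proof.
move=> FW; apply/set0P/negP => /eqP i0.
have := boundary_negligible FW; rewrite i0 setD0.
move/(measure_negligible (tree_measurable tr FW)) => W0.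
by have := tree_pos tr FW; rewrite W0 ltxx.
Qed.

Lemma cell_nonempty k W : F k W -> W !=set0.
Proof. by move=> /interior_cell[x /interior_subset]; exists x. Qed.

Lemma cell_eq k Q Q' x : F k Q -> F k Q' -> Q x -> Q' x -> Q = Q'.
Proof.
by move=> FQ FQ' Qx Q'x; apply: (tree_disjoint tr FQ FQ'); exists x.
Qed.

Lemma exists_ancestor k i W : F (k + i) W -> exists Q, F k Q /\ W `<=` Q.
Proof.
elim: i W => [|i IH] W; first by rewrite addn0 => FW; exists W; split.
rewrite addnS => /(tree_nested tr)[W' /IH[Q [FQ W'Q]] WW'].
by exists Q; split => //; exact: subset_trans WW' W'Q.
Qed.

Lemma ancP k j W : F j W -> (k <= j)%N -> F k (anc k W) /\ W `<=` anc k W.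
Proof.
move=> FW kj; rewrite -(subnKC kj) in FW.
exact: xgetPex (exists_ancestor FW).
Qed.

Lemma anc_eq k j W Q x : F j W -> (k <= j)%N -> F k Q -> W x -> Q x ->
  anc k W = Q.
Proof.
move=> FW kj FQ Wx Qx; have [FA WA] := ancP FW kj.
by apply: (cell_eq FA FQ _ Qx); exact: WA.
Qed.

Lemma anc_sub k j W Q : F j W -> (k <= j)%N -> F k Q -> W `<=` Q -> anc k W = Q.
Proof.
move=> FW kj FQ WQ; have [x Wx] := cell_nonempty FW.
by apply: (anc_eq FW kj FQ Wx); exact: WQ.
Qed.

Lemma anc_id k W : F k W -> anc k W = W.
Proof. by move=> FW; apply: (anc_sub FW). Qed.

Lemma anc_anc k i j W : F j W -> (k <= i <= j)%N -> anc k (anc i W) = anc k W.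
Proof.
move=> FW /andP[ki ij]; have [FA WA] := ancP FW ij.
have [FB WB] := ancP FW (leq_trans ki ij); have [x Wx] := cell_nonempty FW.
by apply: (anc_eq FA ki FB (WA _ Wx)); exact: WB.
Qed.

Lemma sz_decay k i Q W : F k Q -> F (k + i) W -> W `<=` Q ->
  sz W <= l2 ^+ i * sz Q.
Proof.
move=> FQ; have /andP[l20 _] := tree_l2_itv tr.
elim: i W => [|i IH] W.
  rewrite addn0 expr0 mul1r => FW WQ; apply: (le_msize mu1) => //.
    exact: (tree_measurable tr FW).
  exact: (tree_measurable tr FQ).
rewrite addnS => FW WQ; have [W' FW' WW'] := tree_nested tr FW.
have W'Q : W' `<=` Q.
  have [FA WA] := ancP FW' (leq_addr i k).
  have [x Wx] := cell_nonempty FW.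
  by rewrite -(cell_eq FA FQ (WA _ (WW' _ Wx)) (WQ _ Wx)).
have /andP[_ h] := tree_ratio tr FW FW' WW'.
rewrite ler_pdivrMr ?(sz_gt0 FW')// in h.
by rewrite (le_trans h)// exprS -mulrA ler_wpM2l ?(ltW l20)// IH.
Qed.

(** A cell on two levels would have measure at most [l2 ^+ (j - k)] times its own, which is
    positive. *)
Lemma level_unique k j W : F k W -> F j W -> k = j.
Proof.
wlog : k j / (k <= j)%N.
  by move=> H; case: (leqP k j) => [|/ltnW] kj FW FW'; [|apply/esym]; apply: H.
rewrite leq_eqVlt => /predU1P[//|kj] FW FW'.
have /andP[l20 l21] := tree_l2_itv tr.
rewrite -(subnKC (ltnW kj)) in FW'.
have := sz_decay FW FW' (@subset_refl _ _).
rewrite -subr_ge0 -{2}[sz W]mul1r -mulrBl pmulr_lge0 ?(sz_gt0 FW)// subr_ge0.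
by rewrite leNgt exprn_ilt1 ?(ltW l20)// gtn_eqF// subn_gt0.
Qed.

Lemma lvlE k W : F k W -> lvl W = k.
Proof.
by move=> FW; apply: xget_unique => // j FW'; exact: level_unique FW' FW.
Qed.

Lemma cells_disjoint k :
  {in cells F k &, forall W W', W != W' -> W `&` W' = set0}.
Proof.
move=> W W' /cellsP FW /cellsP FW'; move/trivIsetP: (tree_disjoint tr (k := k)).
by apply.
Qed.

Lemma cell_ext k W : F k W ->
  [/\ measurable W, is_interval (W : set R) & W !=set0].
Proof.
move=> FW; split; [exact: (tree_measurable tr FW)|exact: (tree_itv tr FW)|].
exact: cell_nonempty FW.
Qed.

Lemma sum_sz_cells k j Q : F k Q -> (k <= j)%N ->
  \sum_(W <- cells F j | anc k W == Q) sz W <= sz Q.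
Proof.
move=> FQ kj; rewrite -big_filter; have [mQ _ _] := cell_ext FQ.
apply: (sum_msize mu1) => // [|W|W W'].
- by rewrite filter_uniq// cells_uniq.
- rewrite mem_filter => /andP[/eqP <- /cellsP FW].
  by have [? _ _] := cell_ext FW; have [_ ?] := ancP FW kj.
- rewrite !mem_filter => /andP[_ W1] /andP[_ W2]; exact: cells_disjoint W1 W2.
Qed.

(** A cell has at most [l1^-1] children. Rather than counting them, the proof bounds each [h Q] by a
    multiple of [sz W] and adds the measures of the disjoint children inside [Q]. *)
Lemma sum_anc_pred j (h : set T -> R) : (forall W, 0 <= h W) ->
  \sum_(W <- cells F j.+1) h (anc j W) <= l1^-1 * \sum_(W <- cells F j) h W.
Proof.
move=> h0; have l10 := tree_l1_gt0 tr.
rewrite (@sum_fiber _ _ _ (cells F j) (anc j))//; first last.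
- move=> W /cellsP FW; apply/cellsP.
  by have [] := ancP FW (leqnSn j).
- exact: cells_uniq.
rewrite mulr_sumr big_seq [leRHS]big_seq; apply: ler_sum => Q /cellsP FQ.
rewrite (eq_bigr (fun=> h Q)); last by move=> W /eqP ->.
apply: (@le_trans _ _ (\sum_(W <- cells F j.+1 | anc j W == Q)
    (l1^-1 * h Q / sz Q) * sz W)).
  rewrite big_seq_cond [leRHS]big_seq_cond.
  apply: ler_sum => W /andP[/cellsP FW /eqP WQ].
  have [_] := ancP FW (leqnSn j); rewrite WQ => WsQ.
  have /andP[l1W _] := tree_ratio tr FW FQ WsQ.
  rewrite -[leLHS]mul1r; have -> : l1^-1 * h Q / sz Q * sz W =
    (l1^-1 * (sz W / sz Q)) * h Q by ring.
  by rewrite ler_wpM2r// ler_pdivlMl// mulr1.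
rewrite -mulr_sumr (le_trans (ler_wpM2l _ (sum_sz_cells FQ (leqnSn j))))//.
  by rewrite !mulr_ge0// invr_ge0 ?msize_ge0// ltW.
by rewrite divfK// gt_eqF// (sz_gt0 FQ).
Qed.

End tree_theory.
End grid_trees.

(** * Complex-valued measurable functions *)

Section complex_measurability.
Context d (T : measurableType d) (R : realType).
Implicit Types f g : T -> R[i].

Definition cmeasurable f :=
  measurable_fun setT (fun x => complex.Re (f x)) /\
  measurable_fun setT (fun x => complex.Im (f x)).

Lemma cmeasurableD f g : cmeasurable f -> cmeasurable g ->
  cmeasurable (fun x => f x + g x).
Proof.
move=> [f1 f2] [g1 g2]; split.
  apply: eq_measurable_fun (measurable_funD f1 g1) => x _ /=.
  by case: (f x) (g x) => [? ?] [? ?].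
apply: eq_measurable_fun (measurable_funD f2 g2) => x _ /=.
by case: (f x) (g x) => [? ?] [? ?].
Qed.

Lemma cmeasurableZ (c : R[i]) f : cmeasurable f ->
  cmeasurable (fun x => c * f x).
Proof.
move=> [f1 f2]; case: c => u v.
have m (r : R) h : measurable_fun setT h ->
    measurable_fun setT (fun x : T => r * h x).
  by move=> mh; apply: measurable_funM => //; exact: measurable_cst.
split.
  apply: eq_measurable_fun (measurable_funB (m u _ f1) (m v _ f2)) => x _ /=.
  by case: (f x) => [? ?].
apply: eq_measurable_fun (measurable_funD (m u _ f2) (m v _ f1)) => x _ /=.
by case: (f x) => [a b] /=; ring.
Qed.

Lemma cmeasurable0 : cmeasurable (fun=> 0).
Proof. by split; exact: measurable_cst. Qed.

Lemma cmeasurableB f g : cmeasurable f -> cmeasurable g ->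
  cmeasurable (fun x => f x - g x).
Proof.
move=> mf /(cmeasurableZ (-1)) mg.
by under eq_fun do rewrite -mulN1r; exact: cmeasurableD.
Qed.

Lemma cmeasurable_sum (I : eqType) (r : seq I) (F : I -> T -> R[i]) :
  (forall i, i \in r -> cmeasurable (F i)) ->
  cmeasurable (fun x => \sum_(i <- r) F i x).
Proof.
elim: r => [|i r IH] mF.
  by under eq_fun do rewrite big_nil; exact: cmeasurable0.
under eq_fun do rewrite big_cons.
apply: cmeasurableD; first exact: mF (mem_head _ _).
by apply: IH => j jr; apply: mF; rewrite inE jr orbT.
Qed.

Lemma cmeasurable_step (A : set T) (c : R[i]) : measurable A ->
  cmeasurable (fun x => c * (\1_A x : R)%:C%C).
Proof.
move=> mA; apply: cmeasurableZ; split => /=.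
  exact: measurable_indic.
exact: measurable_cst.
Qed.

Lemma measurable_cabs f : cmeasurable f ->
  measurable_fun setT (fun x => cabs (f x)).
Proof.
move=> [f1 f2].
have m2 (h : T -> R) : measurable_fun setT h ->
    measurable_fun setT (fun x : T => h x ^+ 2).
  by move=> mh; exact: measurable_funX.
have := measurable_funD (m2 _ f1) (m2 _ f2) => m.
apply: eq_measurable_fun (measurableT_comp (measurable_powR 2^-1) m) => x _.
by rewrite /= powR12_sqrt ?addr_ge0 ?sqr_ge0//; case: (f x).
Qed.

Variable mu : {measure set T -> \bar R}.

Lemma le_Lnorm_ae (p : R) (f g : T -> R) : 0 <= p ->
  measurable_fun setT f -> measurable_fun setT g -> (forall x, 0 <= f x) ->
  (forall x, 0 <= g x) -> {ae mu, forall x, f x <= g x} ->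
  ('N[mu]_p%:E[EFin \o f] <= 'N[mu]_p%:E[EFin \o g])%E.
Proof.
move=> p0 mf mg f0 g0 fg; rewrite unlock /=.
have m (h : T -> R) : measurable_fun setT h ->
    measurable_fun setT (fun x : T => (`|(h x)%:E| `^ p)%E).
  move=> mh; apply: (@measurableT_comp _ _ _ _ _ _ (fun x => x `^ p)%E) => //.
    exact: measurable_poweR.
  by apply: measurableT_comp => //; exact/measurable_EFinP.
have i0 (h : T -> R) : (0 <= \int[mu]_x (`|(h x : R)%:E| `^ p))%E.
  by apply: integral_ge0 => x _; exact: poweR_ge0.
have iI (h : T -> R) : (\int[mu]_x (`|(h x)%:E| `^ p))%E \in `[0%E, +oo%E].
  by rewrite in_itv/= i0 leey.
apply: gt0_ler_poweR (iI _) (iI _) _; first by rewrite invr_ge0.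
apply: ae_ge0_le_integral => //; first by move=> x _; exact: poweR_ge0.
- exact: m.
- by move=> x _; exact: poweR_ge0.
- exact: m.
apply: filterS fg => x fgx _.
by rewrite /= !lee_fin !ger0_norm// ler_powR2l.
Qed.

Lemma cLnormD (p : R) f g : 1 <= p -> cmeasurable f -> cmeasurable g ->
  (cLnorm mu p%:E (fun x => f x + g x)%R <=
   cLnorm mu p%:E f + cLnorm mu p%:E g)%E.
Proof.
move=> p1 mf mg; have p0 : 0 <= p by rewrite (le_trans _ p1).
have mf' := measurable_cabs mf; have mg' := measurable_cabs mg.
apply: (le_trans _ (minkowski_EFin mu mf' mg' p1)); rewrite /cLnorm.
apply: le_Lnorm_ae => //.
- exact/measurable_cabs/cmeasurableD.
- exact: measurable_funD.
- by move=> x; exact: cabs_ge0.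
- by move=> x /=; rewrite addr_ge0 ?cabs_ge0.
- by apply: aeW => x /=; exact: cabsD.
Qed.

(** At most one indicator is nonzero at each point, so the power passes inside the sum. *)
Lemma Lnorm_sum_indic (p : R) (s : seq (set T)) (v : set T -> R) :
  0 < p -> uniq s -> {in s, forall W, measurable W} ->
  {in s &, forall W W', W != W' -> W `&` W' = set0} -> (forall W, 0 <= v W) ->
  ('N[mu]_p%:E[EFin \o (fun x => \sum_(W <- s) v W * \1_W x)%R] =
  (\sum_(W <- s) (v W `^ p)%:E * mu W) `^ p^-1)%E.
Proof.
move=> p0 us ms ds v0; rewrite unlock /=; congr (_ `^ _)%E.
transitivity (\int[mu]_x (\sum_(W <- s) (v W `^ p)%:E * (\1_W x)%:E)%E)%E.
  apply: eq_integral => x _; rewrite /= ger0_norm; last first.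
    by apply: sumr_ge0 => W _; rewrite mulr_ge0.
  under [RHS]eq_bigr do rewrite -EFinM.
  rewrite sumEFin; congr EFin.
  have [[W sW Wx]|noW] := pselect (exists2 W, W \in s & W x); last first.
    rewrite big1_seq ?powR0 ?gt_eqF// ?big1_seq// => W /andP[_ sW];
    by rewrite indicE memNset ?mulr0// => Wx; apply: noW; exists W.
  rewrite (bigD1_seq W)//= [RHS](bigD1_seq W)//= !indicE mem_set// !mulr1.
  have z W' : W' \in s -> W' != W -> \1_W' x = 0 :> R.
    move=> sW' WW'; rewrite indicE memNset// => Wx'.
    by have : (W' `&` W) x by []; rewrite ds.
  by rewrite !big1_seq ?addr0// => W' /andP[WW' sW']; rewrite z ?mulr0.
have mn i : measurable (nth set0 s i).
  have [si|si] := ltnP i (size s); last by rewrite nth_default.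
  by apply: ms; exact: mem_nth.
under eq_integral do rewrite (big_nth set0).
rewrite ge0_integral_sum//.
- rewrite [RHS](big_nth set0); apply: eq_bigr => i _.
  rewrite ge0_integralZl ?lee_fin ?powR_ge0//.
    by rewrite integral_indic// setIT.
  by apply/measurable_EFinP; exact: measurable_indic.
- move=> i; apply: emeasurable_funM; first exact: measurable_cst.
  by apply/measurable_EFinP; exact: measurable_indic.
- by move=> i x _; rewrite mule_ge0// lee_fin// powR_ge0.
Qed.


End complex_measurability.

(** * Step functions on a tree *)

Section expansions.
Variable R : realType.
Notation T := (measurableTypeR R).
Variable mu : {measure set T -> \bar R}.
Variables (l1 l2 : R) (F : nat -> set (set T)) (top : set T).
Hypothesis tr : grid_tree mu l1 l2 F top.
Variable p : R.
Hypothesis p1 : 1 <= p.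

Local Notation anc := (ancestor F).
Local Notation lvl := (tree_level F).
Local Notation sz := (msize mu).

Let p0 : 0 < p. Proof. by rewrite (lt_le_trans _ p1). Qed.

Lemma cell_sub_top k W : F k W -> W `<=` top.
Proof.
move=> FW; have [] := ancP tr FW (leq0n k).
by rewrite (tree_top tr) => ->.
Qed.

Lemma top_cell : F 0%N top.
Proof. by rewrite (tree_top tr). Qed.

Lemma sz_le_geom k W : F k W -> sz W <= l2 ^+ k.
Proof.
move=> FW; have /andP[l20 _] := tree_l2_itv tr.
rewrite (le_trans (sz_decay tr top_cell FW (cell_sub_top FW)))//.
by rewrite ler_piMr ?exprn_ge0 ?(ltW l20)// (sz_le1 tr top_cell).
Qed.

(** The comparison of [f] with the step function of values [v W] can fail only at the ends of the
    cells and on the part of [top] missed by level [n]; both are null. *)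
Lemma cLnorm_le_step n (f : T -> R[i]) (v : set T -> R) : cmeasurable f ->
  (forall W, 0 <= v W) ->
  (forall W x, F n W -> interior (W : set R) x -> cabs (f x) <= v W) ->
  (forall x, ~ top x -> f x = 0) ->
  (cLnorm mu p%:E f <=
    ((\sum_(W <- cells F n) sz W * v W `^ p) `^ p^-1)%:E)%E.
Proof.
move=> mf v0 fv f0.
pose g x := \sum_(W <- cells F n) v W * (\1_W x : R).
have mcell W : W \in cells F n -> measurable W.
  by move=> /(cellsP tr) FW; exact: (tree_measurable tr FW).
have g0 x : 0 <= g x by apply: sumr_ge0 => W _; rewrite mulr_ge0.
have mg : measurable_fun setT g.
  rewrite /g; have : {subset cells F n <= cells F n} by [].
  move: {1 3}(cells F n) => r; elim: r => [|W r IH] rs.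
    by under eq_fun do rewrite big_nil; exact: measurable_cst.
  under eq_fun do rewrite big_cons.
  apply: measurable_funD.
    apply: measurable_funM; first exact: measurable_cst.
    by apply: measurable_indic; apply: mcell; apply: rs; rewrite in_cons eqxx.
  by apply: IH => W' W'r; apply: rs; rewrite inE W'r orbT.
have -> : ((\sum_(W <- cells F n) sz W * v W `^ p) `^ p^-1)%:E =
    ('N[mu]_p%:E[EFin \o g])%E.
  rewrite Lnorm_sum_indic//; last first.
  - exact: (cells_disjoint tr).
  - exact: cells_uniq.
  rewrite -poweR_EFin -sumEFin; congr (_ `^ _)%E.
  rewrite big_seq [RHS]big_seq; apply: eq_bigr => W /mcell mW.
  by rewrite (msize_fin (tree_le1 tr))// -EFinM mulrC.
apply: le_Lnorm_ae => //; first exact: ltW.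
- exact: measurable_cabs.
- by move=> x; exact: cabs_ge0.
have ncell : mu.-negligible (\bigcup_(W in F n) (W `\` interior (W : set R))).
  rewrite -(bigsetU_fset_set _ (tree_finite tr n)).
  have : {subset cells F n <= cells F n} by [].
  rewrite -/(cells F n).
  move: {1 3}(cells F n) => r; elim: r => [|W r IH] rs.
    by rewrite big_nil; exact: negligible_set0.
  rewrite big_cons; apply: negligibleU; last first.
    by apply: IH => W' W'r; apply: rs; rewrite inE W'r orbT.
  apply: (@boundary_negligible _ _ _ _ _ _ tr n).
  by apply/(cellsP tr)/rs; rewrite in_cons eqxx.
have ncov := tree_cover tr n.
have nN := negligibleU ncell ncov.
apply: (@negligibleS _ _ R mu _ _ _ nN) => x /= fgx.
have [tx|ntx] := pselect (top x); last first.
  by exfalso; apply: fgx; rewrite f0// cabs0.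
have [[W FW Wx]|nW] := pselect ((\bigcup_(W in F n) W) x); last by right.
left; exists W => //; split => // iWx; apply: fgx.
have /(cellsP tr) sW := FW.
rewrite /g (bigD1_seq W)//= ?cells_uniq// indicE mem_set// mulr1.
rewrite (le_trans (fv _ _ FW iWx))// lerDl.
by apply: sumr_ge0 => V _; rewrite mulr_ge0.
Qed.

Section layers.
Variables (c : set T -> R[i]) (a : set T -> T -> R[i]).
Hypothesis a_out : forall k Q, F k Q -> vanishes_outside Q (a Q).

Lemma layerE k j W x : F j W -> (k <= j)%N -> W x ->
  layer F c a k x = c (anc k W) * a (anc k W) x.
Proof.
move=> FW kj Wx; rewrite /layer (fsum_cells tr).
have [FA WA] := ancP tr FW kj; have /(cellsP tr) sA := FA.
rewrite (bigD1_seq (anc k W))//= ?cells_uniq//.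
rewrite big1_seq ?addr0// => Q /andP[QA /(cellsP tr) FQ].
rewrite (a_out FQ) ?mulr0// => Qx.
by move: QA; rewrite (cell_eq tr FQ FA Qx (WA _ Wx)) eqxx.
Qed.

Lemma layer_out k x : ~ top x -> layer F c a k x = 0.
Proof.
move=> tx; rewrite /layer (fsum_cells tr).
rewrite big1_seq// => Q /andP[_ /(cellsP tr) FQ].
by rewrite (a_out FQ) ?mulr0// => /(cell_sub_top FQ).
Qed.

Lemma cmeasurable_layer k : (forall k Q, F k Q -> cmeasurable (a Q)) ->
  cmeasurable (layer F c a k).
Proof.
move=> ma; rewrite /layer; under eq_fun do rewrite (fsum_cells tr).
by apply: cmeasurable_sum => Q /(cellsP tr) FQ; exact/cmeasurableZ/(ma _ _ FQ).
Qed.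

(** [layer_sum n] stops at level [n - 1], so the sum that belongs to the cells of level [n] is
    [layer_sum n.+1]. *)
Definition layer_sum n x := \sum_(0 <= k < n) layer F c a k x.

Lemma layer_sumE n j W x : F j W -> (n <= j.+1)%N -> W x ->
  layer_sum n x = \sum_(0 <= k < n) c (anc k W) * a (anc k W) x.
Proof.
move=> FW nj Wx; rewrite /layer_sum !big_nat; apply: eq_bigr => k /andP[_ kn].
by apply: layerE FW _ Wx; rewrite -ltnS (leq_trans kn).
Qed.

Lemma layer_sum_out n x : ~ top x -> layer_sum n x = 0.
Proof. by move=> tx; rewrite /layer_sum big1// => k _; exact: layer_out. Qed.

Lemma cmeasurable_layer_sum n : (forall k Q, F k Q -> cmeasurable (a Q)) ->
  cmeasurable (layer_sum n).
Proof.
by move=> ma; apply: cmeasurable_sum => k _; exact: cmeasurable_layer.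
Qed.

End layers.

(** The point is taken in the interior because [pvar] sees no other points; 0 is a default for sets
    with empty interior. *)
Definition pt (W : set T) : R := xget 0 (interior (W : set R)).

Lemma pt_interior k W : F k W -> interior (W : set R) (pt W).
Proof. by move=> /(interior_cell tr); exact: xgetPex. Qed.

Lemma pt_cell k W : F k W -> W (pt W).
Proof. by move=> /pt_interior /interior_subset. Qed.

Section increments.
Variables (s : R) (S : nat -> T -> R[i]).

(* [S n] stands for a partial sum of an atomic decomposition: the new layers
   telescope to the step function with value [S n (pt W)] on each [W] of
   level [n]. *)
Definition increment (W : set T) : R[i] :=
  S (lvl W).+1 (pt W) -
  (if lvl W is j.+1 then S j.+1 (pt (anc j W)) else 0).

(** The Souza atom of maximal height. [flat_coef] carries the inverse power of the measure, so that
    their product on [W] is [increment W]. *)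
Definition flat_atom (W : set T) (x : T) : R[i] :=
  ((sz W `^ (s - p^-1)) * \1_W x)%:C%C.

Definition flat_coef (W : set T) : R[i] :=
  ((sz W `^ (p^-1 - s))%:C)%C * increment W.

Lemma flat_atom_out W : vanishes_outside W (flat_atom W).
Proof. by move=> x Wx; rewrite /flat_atom indicE memNset// mulr0. Qed.

Lemma flat_atom_souza k W : F k W -> souza_atom mu s p W (flat_atom W).
Proof.
move=> FW; split; last 2 first.
- exact: flat_atom_out.
- move=> x; rewrite /flat_atom cabs_real ger0_norm ?mulr_ge0 ?powR_ge0//.
  by rewrite indicE; case: (x \in W); rewrite ?mulr1// mulr0 powR_ge0.
- exists ((sz W `^ (s - p^-1))%:C)%C => x Wx.
  by rewrite /flat_atom indicE mem_set// mulr1.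
Qed.

Lemma flat_layer_sum n W x : F n W -> W x ->
  layer_sum flat_coef flat_atom n.+1 x = S n.+1 (pt W).
Proof.
move=> FW Wx.
have ao k Q : F k Q -> vanishes_outside Q (flat_atom Q).
  by move=> _; exact: flat_atom_out.
have E k V y : F k V -> V y -> layer F flat_coef flat_atom k y = increment V.
  move=> FV Vy; rewrite (layerE _ ao FV)// (anc_id tr FV).
  rewrite /flat_coef /flat_atom indicE mem_set// mulr1 mulrAC -rmorphM/=.
  rewrite -powRD ?addrA ?subrK ?subrr ?powRr0 ?mul1r//.
  by rewrite (gt_eqF (sz_gt0 tr FV)) implybT.
elim: n W FW Wx => [|n IH] W FW Wx.
  rewrite /layer_sum big_nat1 (E _ _ _ FW Wx) /increment (lvlE tr FW).
  by rewrite subr0.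
have [FA WA] := ancP tr FW (leqnSn n).
rewrite /layer_sum big_nat_recr//= -/(layer_sum _ _ _ _) (IH _ FA (WA _ Wx)).
rewrite (E _ _ _ FW Wx) /increment (lvlE tr FW).
by rewrite addrC subrK.
Qed.

End increments.
End expansions.

(** * Resampling an atomic decomposition *)

(** Here [w] is the measure of a cell below one of measure [q], [e] bounds their ratio, [o] is an
    oscillation of the atom on the large cell, and the power of [q] under [o] is the bound on its
    total variation. With u = bp, the power w^(1 - sp) splits into w^((b-s)p), which yields the
    decay, and w^(1-u), which is interpolated with o^u. Normalizing [w] and [o] produces q^((s-b)p),
    cancelled by the first factor. *)
Lemma weighted_cell_bound (R : realType) (p s b w q e C o : R) :
  0 < p -> 0 < s -> s <= b -> b <= p^-1 -> 0 < w -> 0 < q -> 0 <= e ->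
  w <= e * q -> 0 <= C -> 0 <= o ->
  (w `^ (p^-1 - s) * (C * o `^ b)) `^ p <=
  C `^ p * (e `^ (b - s)) `^ p * (w / q + o / q `^ ((s - p^-1) / b)).
Proof.
move=> p0 s0 sb bp w0 q0 e0 weq C0 o0.
have b0 : 0 < b by exact: lt_le_trans sb.
set X := q `^ _; have X0 : 0 < X by exact: powR_gt0.
pose u := b * p.
have u01 : 0 <= u <= 1.
  by rewrite /u mulr_ge0 ?(ltW b0) ?(ltW p0)//= -ler_pdivlMr// mul1r.
have pne : p != 0 by rewrite gt_eqF.
have bne : b != 0 by rewrite gt_eqF.
have E1 : (w `^ (p^-1 - s) * (C * o `^ b)) `^ p =
    C `^ p * (w `^ ((b - s) * p) * (w `^ (1 - u) * o `^ u)).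
  rewrite !powRM ?powR_ge0 ?mulr_ge0 ?powR_ge0// -!powRrM.
  rewrite mulrCA; congr (_ * _); rewrite mulrA; congr (_ * _).
  rewrite -powRD; last by rewrite (gt_eqF w0) implybT.
  by congr (_ `^ _); rewrite /u; field.
have E2 : w `^ (1 - u) * o `^ u =
    q `^ ((s - b) * p) * ((w / q) `^ (1 - u) * (o / X) `^ u).
  have split_div (x y r : R) : 0 <= x -> 0 < y ->
      x `^ r = y `^ r * (x / y) `^ r.
    move=> x0 y0; have xy0 : 0 <= x / y by rewrite divr_ge0// ltW.
    by rewrite -(powRM _ (ltW y0) xy0) mulrCA divff ?mulr1// gt_eqF.
  rewrite (split_div w q (1 - u) (ltW w0) q0) (split_div o X u o0 X0).
  have -> : X `^ u = q `^ (s * p - 1).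
    by rewrite /X -powRrM; congr (_ `^ _); rewrite /u; field; rewrite bne.
  have -> : q `^ ((s - b) * p) = q `^ (1 - u) * q `^ (s * p - 1).
    rewrite -powRD; last by rewrite (gt_eqF q0) implybT.
    by congr (_ `^ _); rewrite /u; ring.
  by ring.
rewrite E1 E2 -mulrA ler_wpM2l ?powR_ge0// mulrA.
apply: ler_pM.
- by rewrite mulr_ge0 ?powR_ge0.
- by rewrite mulr_ge0 ?powR_ge0.
- apply: (@le_trans _ _ ((e * q) `^ ((b - s) * p) * q `^ ((s - b) * p))).
    rewrite ler_wpM2r ?powR_ge0// ler_powR2l ?(ltW w0)//.
    by rewrite mulr_ge0 ?subr_ge0// ltW.
  rewrite powRM ?(ltW q0)// -mulrA -powRD; last by rewrite (gt_eqF q0) implybT.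
  have -> : (b - s) * p + (s - b) * p = 0 by ring.
  by rewrite powRr0 mulr1 -powRrM.
by apply: powR_interp => //; rewrite divr_ge0// ltW.
Qed.

(** * Estimates of the new coefficients, layers and remainders *)

Section besov_expansion.
Variable R : realType.
Notation T := (measurableTypeR R).
Variable mu : {measure set T -> \bar R}.
Variables (l1 l2 : R) (F : nat -> set (set T)) (top : set T).
Hypothesis tr : grid_tree mu l1 l2 F top.
Variables p s b : R.
Hypothesis p1 : 1 <= p.
Hypothesis s0 : 0 < s.
Hypothesis sb : s <= b.
Hypothesis bp : b <= p^-1.

Local Notation anc := (ancestor F).
Local Notation lvl := (tree_level F).
Local Notation sz := (msize mu).

Variables (c : set T -> R[i]) (a : set T -> T -> R[i]).

(* Up to a factor two, what a bounded variation atom satisfies; unlike the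
   essential supremum, the bound on [interior Q] can be evaluated pointwise. *)
Definition bv_cell (Q : set T) (f : T -> R[i]) :=
  [/\ vanishes_outside Q f,
      forall x, interior (Q : set R) x -> cabs (f x) <= 2 * sz Q `^ (s - p^-1) &
      var_bounded b f Q (sz Q `^ ((s - p^-1) / b))].

Hypothesis bva : forall k Q, F k Q -> bv_cell Q (a Q).

Let p0 : 0 < p. Proof. by rewrite (lt_le_trans _ p1). Qed.
Let b0 : 0 < b. Proof. exact: lt_le_trans sb. Qed.
Let l20 : 0 < l2. Proof. by have /andP[] := tree_l2_itv tr. Qed.

Let X (Q : set T) : R := sz Q `^ ((s - p^-1) / b).
Let A := level_norm F p c.
Let mu_ : R := l2 `^ (b - s).
Let Cst : R := 3 + l1^-1.

Let A0 k : 0 <= A k. Proof. exact: powR_ge0. Qed.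

Let Ap k : A k `^ p = \sum_(Q <- cells F k) cabs (c Q) `^ p.
Proof.
by rewrite powR_rootK ?gt_eqF// sumr_ge0// => Q _; exact: powR_ge0.
Qed.

(** The three losses that [Cst] absorbs: [1 + 1] for the remainder, where oscillations run over
    disjoint cells; [1 + l1^-1] for the coefficients, where they run over parents; 2 for the
    supremum bound in [bv_cell]. The power [p] is harmless since [p] and [Cst] are at least one. *)
Let CstP : 1 + 1 <= Cst `^ p /\ 1 + l1^-1 <= Cst `^ p /\ 2 <= Cst.
Proof.
have l10 : 0 < l1^-1 by rewrite invr_gt0; exact: (tree_l1_gt0 tr).
have : Cst <= Cst `^ p by apply: le1r_powR => //; rewrite /Cst; lra.
by rewrite /Cst; lra.
Qed.

Let conv_ge0 j : 0 <= geom_conv mu_ A j.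
Proof. by apply: geom_conv_ge0 => //; exact: powR_ge0. Qed.

Let Cst0 : 0 <= Cst.
Proof. by have [_ [_ C2]] := CstP; rewrite (le_trans _ C2). Qed.

Lemma bv_variation_function : exists U : set T -> R -> R,
  forall k Q, F k Q -> [/\ nondecreasing_fun (U Q),
    forall x, 0 <= U Q x <= X Q &
    forall x y, interior (Q : set R) x -> interior (Q : set R) y ->
      cabs (a Q x - a Q y) `^ b^-1 <= `|U Q x - U Q y|].
Proof.
have H (Q : set T) : exists u : R -> R, forall k, F k Q ->
    [/\ nondecreasing_fun u,
    forall x, 0 <= u x <= X Q &
    forall x y, interior (Q : set R) x -> interior (Q : set R) y ->
      cabs (a Q x - a Q y) `^ b^-1 <= `|u x - u y|].
  have [[k FQ]|noF] := pselect (exists k, F k Q); last first.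
    by exists id => k FQ; exfalso; apply: noF; exists k.
  have [_ _ v] := bva FQ.
  have [u uP] := variation_function (lt0r_neq0 b0) v.
  by exists u.
have [U UP] := choice H.
by exists U => k Q; exact: UP.
Qed.

Section with_variation.
Variable U : set T -> R -> R.
Hypothesis UP : forall k Q, F k Q -> [/\ nondecreasing_fun (U Q),
    forall x, 0 <= U Q x <= X Q &
    forall x y, interior (Q : set R) x -> interior (Q : set R) y ->
      cabs (a Q x - a Q y) `^ b^-1 <= `|U Q x - U Q y|].

Let osc_U0 k Q W : F k Q -> 0 <= osc (U Q) W.
Proof. by move=> FQ; have [_ UX _] := UP FQ; exact: osc_ge0 UX _. Qed.

Let a_osc k Q (W : set T) x y : F k Q -> W `<=` Q ->
  interior (W : set R) x -> interior (W : set R) y ->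
  cabs (a Q x - a Q y) <= osc (U Q) W `^ b.
Proof.
move=> FQ WQ Wx Wy; have [_ UX aU] := UP FQ.
have iWQ : interior (W : set R) `<=` interior (Q : set R).
  exact: interiorS.
rewrite -[leLHS](@powR_Kroot _ b^-1) ?invr_eq0 ?gt_eqF ?cabs_ge0// invrK.
rewrite ler_powR2l ?powR_ge0 ?(ltW b0)//.
apply: (le_trans (aU _ _ (iWQ _ Wx) (iWQ _ Wy))).
by apply: (le_osc UX); exact: interior_subset.
Qed.

Let sum_osc_cells k j Q : F k Q ->
  \sum_(W <- cells F j | anc k W == Q) osc (U Q) W <= X Q.
Proof.
move=> FQ; have [Um UX _] := UP FQ; rewrite -big_filter; apply: sum_osc => //.
- by rewrite filter_uniq// cells_uniq.
- by move=> W; rewrite mem_filter => /andP[_ /(cellsP tr) /(cell_ext tr)[]].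
- move=> W W'; rewrite !mem_filter => /andP[_ sW] /andP[_ sW'].
  exact: (cells_disjoint tr sW sW').
Qed.

(** Contribution of the atom on the level [k] ancestor of [W], measured by its oscillation on [Y].
    The set [Y] is the parent of [W] for the coefficients and [W] itself for the remainder. *)
Let g k (W Y : set T) : R :=
  sz W `^ (p^-1 - s) * (cabs (c (anc k W)) * osc (U (anc k W)) Y `^ b).

Let g_ge0 k W Y : 0 <= g k W Y.
Proof. by rewrite !mulr_ge0 ?powR_ge0 ?cabs_ge0. Qed.

(** Grouping the cells by ancestor leaves one atom at a time. In [1 + N] the 1 comes from the
    relative measures of the cells below [Q], and [N] from the normalized oscillations. *)
Let sum_g k j (phi : set T -> set T) N : (k <= j)%N -> 0 <= N ->
  (forall Q, F k Q ->
    \sum_(W <- cells F j | anc k W == Q) osc (U Q) (phi W) <= N * X Q) ->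
  \sum_(W <- cells F j) g k W (phi W) `^ p <=
  (1 + N) * (mu_ ^+ (j - k) * A k) `^ p.
Proof.
move=> kj N0 H.
rewrite (@sum_fiber _ _ _ _ (cells F k) (anc k)); first last.
- by move=> W /(cellsP tr) FW; apply/(cellsP tr); have [] := ancP tr FW kj.
- exact: cells_uniq.
rewrite powRM ?exprn_ge0 ?powR_ge0// Ap mulrA mulr_sumr.
rewrite big_seq [leRHS]big_seq; apply: ler_sum => Q /(cellsP tr) FQ.
have q0 := sz_gt0 tr FQ.
apply: (@le_trans _ _ (\sum_(W <- cells F j | anc k W == Q)
    (cabs (c Q) `^ p * (mu_ ^+ (j - k)) `^ p *
      (sz W / sz Q + osc (U Q) (phi W) / X Q)))).
  rewrite big_seq_cond [leRHS]big_seq_cond.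
  apply: ler_sum => W /andP[/(cellsP tr) FW /eqP WQ].
  have [_] := ancP tr FW kj; rewrite WQ => WsQ.
  have -> : mu_ ^+ (j - k) = (l2 ^+ (j - k)) `^ (b - s).
    by rewrite (powR_exprn _ _ (ltW l20)).
  rewrite /g WQ; apply: weighted_cell_bound => //.
  - exact: (sz_gt0 tr FW).
  - by rewrite exprn_ge0// ltW.
  - by rewrite -(subnKC kj) in FW; exact: (sz_decay tr FQ FW WsQ).
  - exact: cabs_ge0.
  - exact: (osc_U0 _ FQ).
rewrite -mulr_sumr [leRHS](_ : _ =
  cabs (c Q) `^ p * (mu_ ^+ (j - k)) `^ p * (1 + N)); last by ring.
rewrite ler_wpM2l ?mulr_ge0 ?powR_ge0//.
rewrite big_split/= -!mulr_suml lerD//.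
  by rewrite ler_pdivrMr// mul1r; exact: (sum_sz_cells tr FQ kj).
by rewrite ler_pdivrMr ?powR_gt0// H.
Qed.

Local Notation S := (layer_sum F c a).
Local Notation t := (flat_coef mu F p s S).
Local Notation e := (flat_atom mu p s).

Let a_out k Q : F k Q -> vanishes_outside Q (a Q).
Proof. by move=> /bva[]. Qed.

(** The atom on [W] itself has no counterpart in the sample at the parent, so the diagonal term
    bounds a value and not an oscillation. For [k < j] the level [j.-1] is truly the parent
    level. *)
Let h (j k : nat) (W : set T) : R :=
  if k == j then 2 * cabs (c W) else g k W (anc j.-1 W).

Let h_ge0 j k W : 0 <= h j k W.
Proof.
rewrite /h; case: ifP => _; last exact: g_ge0.
by apply: mulr_ge0 => //; exact: cabs_ge0.
Qed.

Let sum_h j k : (k <= j)%N ->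
  \sum_(W <- cells F j) h j k W `^ p <= (Cst * (mu_ ^+ (j - k) * A k)) `^ p.
Proof.
have [_ [CP C2]] := CstP.
have C0 : 0 <= Cst by rewrite (le_trans _ C2).
have m0 i : 0 <= mu_ ^+ i by rewrite exprn_ge0// powR_ge0.
rewrite leq_eqVlt => /predU1P[->|kj].
  rewrite subnn expr0 mul1r powRM// Ap mulr_sumr; apply: ler_sum => W _.
  rewrite /h eqxx powRM ?cabs_ge0// ler_wpM2r ?powR_ge0//.
  by rewrite ler_powR2l// ltW.
rewrite powRM ?mulr_ge0//.
rewrite (eq_bigr (fun W => g k W (anc j.-1 W) `^ p)); last first.
  by move=> W _; rewrite /h ltn_eqF.
have N0 : 0 <= l1^-1 by rewrite invr_ge0 ltW// (tree_l1_gt0 tr).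
apply: (@le_trans _ _ ((1 + l1^-1) * (mu_ ^+ (j - k) * A k) `^ p)); last first.
  by rewrite ler_wpM2r ?powR_ge0.
apply: sum_g; rewrite ?(ltnW kj)// => Q FQ.
case: j kj => // j; rewrite ltnS => kj /=.
(* The oscillations depend on [W] only through its parent; extended by zero to all cells of level
   [j], they can be summed over parents at the price of [l1^-1]. *)
pose f V := if anc k V == Q then osc (U Q) V else 0.
apply: (@le_trans _ _ (l1^-1 * \sum_(V <- cells F j) f V)); last first.
  by rewrite ler_wpM2l// -big_mkcond; exact: sum_osc_cells.
apply: le_trans (sum_anc_pred tr _ _); last first.
  by move=> V; rewrite /f; case: ifP => // _; exact: osc_U0 FQ.
rewrite big_mkcond big_seq [leRHS]big_seq; apply: ler_sum => W /(cellsP tr) FW.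
by rewrite /f (anc_anc tr FW) ?kj ?leqnSn.
Qed.

Let coef_le j W : F j W -> cabs (t W) <= \sum_(0 <= k < j.+1) h j k W.
Proof.
move=> FW; rewrite /flat_coef cabsM cabs_real ger0_norm ?powR_ge0//.
have Wpt := pt_interior tr FW.
have last_le : sz W `^ (p^-1 - s) * cabs (c W * a W (pt W)) <= h j j W.
  rewrite /h eqxx cabsM mulrCA mulrC ler_wpM2r ?cabs_ge0//.
  have [_ /(_ _ Wpt) aW _] := bva FW.
  rewrite (le_trans (ler_wpM2l (powR_ge0 _ _) aW))// mulrCA.
  rewrite -powRD; last by rewrite (gt_eqF (sz_gt0 tr FW)) implybT.
  by rewrite addrA subrK subrr powRr0 mulr1.
rewrite /increment (lvlE tr FW).
case: j FW last_le => [|j] FW last_le.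
  rewrite subr0 (layer_sumE tr _ a_out FW (leqnn _) (pt_cell tr FW)).
  by rewrite !big_nat1 (anc_id tr FW).
have [FA WA] := ancP tr FW (leqnSn j).
rewrite (layer_sumE tr _ a_out FW (leqnn _) (pt_cell tr FW)).
rewrite (layer_sumE tr _ a_out FA (leqnn _) (pt_cell tr FA)).
rewrite big_nat_recr//= (anc_id tr FW) addrAC -sumrB [in leRHS]big_nat_recr//=.
rewrite (le_trans (ler_wpM2l (powR_ge0 _ _) (cabsD _ _)))// mulrDr lerD//.
rewrite (le_trans (ler_wpM2l (powR_ge0 _ _) (cabs_sum _ _)))// mulr_sumr.
rewrite !big_nat; apply: ler_sum => k /andP[_ kj].
rewrite /h (ltn_eqF kj) /g/= ler_wpM2l ?powR_ge0//.
have kj' : (k <= j < j.+1)%N by rewrite -ltnS kj leqnn.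
have kj'' : (k <= j <= j.+1)%N by rewrite -ltnS kj leqnSn.
rewrite (anc_anc tr FW kj'') -mulrBr cabsM ler_wpM2l ?cabs_ge0//.
have [FB WB] := ancP tr FA (kj : (k <= j)%N).
have [FK WK] := ancP tr FW (leqW (kj : (k <= j)%N)).
apply: (a_osc FK).
- by rewrite -(anc_anc tr FW kj'').
- exact: (interiorS WA).
- exact: (pt_interior tr FA).
Qed.

Let geom_conv_sum j : Cst * geom_conv mu_ A j =
  \sum_(0 <= k < j.+1) Cst * (mu_ ^+ (j - k) * A k).
Proof. by rewrite mulr_sumr. Qed.

(** Minkowski's inequality over the old levels [k] assembles the masses of [sum_h] into the
    convolution. *)
Lemma sum_flat_coef j :
  \sum_(W <- cells F j) cabs (t W) `^ p <= (Cst * geom_conv mu_ A j) `^ p.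
Proof.
apply: (@le_trans _ _
    (\sum_(W <- cells F j) (\sum_(0 <= k < j.+1) h j k W) `^ p)).
  rewrite big_seq [leRHS]big_seq; apply: ler_sum => W /(cellsP tr) FW.
  by rewrite ler_powR2l ?cabs_ge0 ?(ltW p0) ?coef_le.
rewrite geom_conv_sum; apply: minkowski_sum => //.
  by move=> k; rewrite !mulr_ge0// exprn_ge0// powR_ge0.
by move=> k; rewrite mem_index_iota ltnS => /andP[_ kj]; exact: sum_h.
Qed.

Lemma geom_szS j W : F j W -> sz W `^ s <= (l2 `^ s) ^+ j.
Proof.
move=> FW; rewrite -(powR_exprn _ _ (ltW l20)).
by rewrite ler_powR2l ?msize_ge0 ?(ltW s0) ?(sz_le_geom tr FW).
Qed.

Lemma cmeasurable_flat_atom k Q : F k Q -> cmeasurable (e Q).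
Proof.
move=> FQ; rewrite /flat_atom; under eq_fun do rewrite rmorphM/=.
by apply: cmeasurable_step; exact: (tree_measurable tr FQ).
Qed.

Lemma cLnorm_flat_layer j : (cLnorm mu p%:E (layer F t e j) <=
  ((l2 `^ s) ^+ j * (Cst * geom_conv mu_ A j))%:E)%E.
Proof.
have eo k Q : F k Q -> vanishes_outside Q (e Q).
  by move=> _; exact: flat_atom_out.
apply: (le_trans (@cLnorm_le_step _ _ _ _ _ _ tr _ p1 j _
    (fun W => sz W `^ (s - p^-1) * cabs (t W)) _ _ _ _)).
- by apply: (cmeasurable_layer tr) => k Q; exact: cmeasurable_flat_atom.
- by move=> W; rewrite mulr_ge0 ?powR_ge0 ?cabs_ge0.
- move=> W x FW /interior_subset Wx.
  rewrite (layerE tr _ eo FW)// (anc_id tr FW) cabsM mulrC.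
  rewrite ler_wpM2r ?cabs_ge0//.
  by have [_ _] := flat_atom_souza mu p s FW; apply.
- by move=> x; exact: (layer_out tr _ eo).
have r0 : 0 <= (l2 `^ s) ^+ j by rewrite exprn_ge0 ?powR_ge0.
rewrite lee_fin -[leRHS](@powR_Kroot _ p) ?gt_eqF ?mulr_ge0//.
rewrite ler_powR2l ?invr_ge0 ?(ltW p0)//.
  by apply: sumr_ge0 => W _; rewrite mulr_ge0 ?powR_ge0 ?msize_ge0.
rewrite powRM ?mulr_ge0//.
rewrite (le_trans _ (ler_wpM2l (powR_ge0 _ _) (sum_flat_coef j)))//.
rewrite mulr_sumr big_seq [leRHS]big_seq; apply: ler_sum => W /(cellsP tr) FW.
rewrite powRM ?powR_ge0 ?cabs_ge0// mulrA ler_wpM2r ?powR_ge0//.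
have w0 := sz_gt0 tr FW.
have -> : sz W * (sz W `^ (s - p^-1)) `^ p = (sz W `^ s) `^ p.
  rewrite -!powRrM -{1}[sz W]powRr1 ?(ltW w0)// -powRD; last first.
    by rewrite (gt_eqF w0) implybT.
  by congr (_ `^ _); field; rewrite gt_eqF.
by rewrite ler_powR2l ?powR_ge0 ?(ltW p0)// (geom_szS FW).
Qed.

(** On a cell [W] of level [n] the difference is S(x) - S(pt W), so every layer, that of [W]
    included, contributes an oscillation on [W]: the estimate of the coefficients with [phi] the
    identity and no diagonal term. *)
Lemma cLnorm_remainder n : (cLnorm mu p%:E
    (fun x => S n.+1 x - layer_sum F t e n.+1 x)%R <=
  ((l2 `^ s) ^+ n * (Cst * geom_conv mu_ A n))%:E)%E.
Proof.
have eo k Q : F k Q -> vanishes_outside Q (e Q).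
  by move=> _; exact: flat_atom_out.
have ma k Q : F k Q -> cmeasurable (a Q).
  move=> FQ; have [ao _ v] := bva FQ.
  exact: var_bounded_measurable b0 (tree_itv tr FQ) ao v.
pose v W := \sum_(0 <= k < n.+1) cabs (c (anc k W)) * osc (U (anc k W)) W `^ b.
have v0 W : 0 <= v W.
  by apply: sumr_ge0 => k _; rewrite mulr_ge0 ?cabs_ge0 ?powR_ge0.
apply: (le_trans (@cLnorm_le_step _ _ _ _ _ _ tr _ p1 n _ v _ v0 _ _)).
- apply: cmeasurableB; apply: (cmeasurable_layer_sum tr) => //.
  by move=> k Q; exact: cmeasurable_flat_atom.
- move=> W x FW iWx; have Wx := interior_subset iWx.
  rewrite (flat_layer_sum tr _ _ _ FW Wx).
  rewrite (layer_sumE tr _ a_out FW (leqnn _) Wx).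
  rewrite (layer_sumE tr _ a_out FW (leqnn _) (pt_cell tr FW)).
  rewrite -sumrB (le_trans (cabs_sum _ _))// /v !big_nat.
  apply: ler_sum => k /andP[_ kn].
  rewrite -mulrBr cabsM ler_wpM2l ?cabs_ge0//.
  have [FA WA] := ancP tr FW (kn : (k <= n)%N).
  by apply: (a_osc FA WA iWx); exact: (pt_interior tr FW).
- move=> x tx; rewrite (layer_sum_out tr _ a_out)//.
  by rewrite (layer_sum_out tr _ eo)// subr0.
have r0 : 0 <= (l2 `^ s) ^+ n by rewrite exprn_ge0 ?powR_ge0.
rewrite lee_fin -[leRHS](@powR_Kroot _ p) ?gt_eqF ?mulr_ge0//.
rewrite ler_powR2l ?invr_ge0 ?(ltW p0)//.
  by apply: sumr_ge0 => W _; rewrite mulr_ge0 ?powR_ge0 ?msize_ge0.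
rewrite powRM ?mulr_ge0//.
apply: (@le_trans _ _ (((l2 `^ s) ^+ n) `^ p *
    \sum_(W <- cells F n) (\sum_(0 <= k < n.+1) g k W W) `^ p)).
  rewrite mulr_sumr big_seq [leRHS]big_seq; apply: ler_sum => W /(cellsP tr) FW.
  rewrite /g -mulr_sumr -/(v W) [in leRHS]powRM ?powR_ge0// mulrA.
  rewrite ler_wpM2r ?powR_ge0//.
  have w0 := sz_gt0 tr FW.
  (* The weight |W| is split as |W|^(sp) |W|^(1 - sp): the first factor is the geometric gain, the
     second is the one built into [g]. *)
  rewrite {1}(_ : sz W = (sz W `^ s) `^ p * (sz W `^ (p^-1 - s)) `^ p);
    last first.
    rewrite -!powRrM -powRD; last by rewrite (gt_eqF w0) implybT.
    rewrite -[LHS]powRr1 ?(ltW w0)//.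
    by congr (_ `^ _); field; rewrite gt_eqF.
  rewrite ler_wpM2r ?powR_ge0// ler_powR2l ?powR_ge0 ?(ltW p0)//.
  exact: geom_szS.
rewrite ler_wpM2l ?powR_ge0// geom_conv_sum.
apply: minkowski_sum => //.
  by move=> k; rewrite !mulr_ge0// exprn_ge0// powR_ge0.
move=> k; rewrite mem_index_iota ltnS => /andP[_ kn].
have [C2 _] := CstP.
rewrite powRM ?mulr_ge0 ?exprn_ge0 ?powR_ge0//.
rewrite (le_trans _ (ler_wpM2r (powR_ge0 _ _) C2))//.
by apply: (sum_g (phi := id)) => // Q FQ; rewrite mul1r sum_osc_cells.
Qed.

End with_variation.

(** The three bounds answer the three demands on the new representation: its cost, the summability
    of its layers and its convergence. *)
Theorem flat_expansion :
  let t := flat_coef mu F p s (layer_sum F c a) in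
  let e := flat_atom mu p s in
  let bound j :=
    (3 + l1^-1) * geom_conv (l2 `^ (b - s)) (level_norm F p c) j in
  [/\ forall j, level_norm F p t j <= bound j,
      forall j, (cLnorm mu p%:E (layer F t e j) <=
        ((l2 `^ s) ^+ j * bound j)%:E)%E &
      forall n, (cLnorm mu p%:E
          (fun x => layer_sum F c a n.+1 x - layer_sum F t e n.+1 x)%R <=
        ((l2 `^ s) ^+ n * bound n)%:E)%E].
Proof.
have [U UP] := bv_variation_function.
split=> n; [|exact: (cLnorm_flat_layer UP)|exact: (cLnorm_remainder UP)].
have B0 : 0 <= Cst * geom_conv mu_ A n by rewrite mulr_ge0.
rewrite -[leRHS](@powR_Kroot _ p) ?gt_eqF// ler_powR2l ?invr_ge0 ?(ltW p0)//.
  by apply: sumr_ge0 => W _; exact: powR_ge0.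
exact: (sum_flat_coef UP).
Qed.

End besov_expansion.

(** * Grids and costs *)

Section trees_of_grids.
Variable R : realType.
Notation T := (measurableTypeR R).
Variable mu : {measure set T -> \bar R}.

Lemma good_grid_tree (l1 l2 : R) P (I : set T) :
  (forall x : R, mu [set x] = 0) -> (mu setT <= 1)%E ->
  (forall k Q, P k Q -> is_interval (Q : set R)) ->
  good_grid mu I l1 l2 P -> grid_tree mu l1 l2 P I.
Proof.
move=> mu_pt mu1 Pitv [l10 l12 l21 fin mea pos top cov dis nest rat _].
split => //; first by rewrite l21 (lt_trans l10).
by move=> k; apply: (@negligibleS _ _ R mu _ _ _ (cov k)) => x Ix; left.
Qed.

(** A cell of level at least [k0] that meets [Q] lies in [Q], because its ancestor of level [k0] is
    then [Q]. Covering and nesting pass to the subgrid for this reason. *)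
Lemma subgrid_tree (l1 l2 : R) P (I : set T) k0 Q : grid_tree mu l1 l2 P I ->
  P k0 Q -> grid_tree mu l1 l2 (subgrid P k0 Q) Q.
Proof.
move=> tr PQ; split.
- exact: (tree_pt tr).
- exact: (tree_le1 tr).
- exact: (tree_l1_gt0 tr).
- exact: (tree_l2_itv tr).
- move=> k; apply: sub_finite_set (tree_finite tr (k0 + k)) => W.
  by move=> [].
- by move=> k W [FW _]; exact: (tree_measurable tr FW).
- by move=> k W [FW _]; exact: (tree_itv tr FW).
- by move=> k W [FW _]; exact: (tree_pos tr FW).
- apply/seteqP; split=> W.
    rewrite /subgrid/= addn0 => -[FW WQ]; have [x Wx] := cell_nonempty tr FW.
    exact: (cell_eq tr FW PQ Wx (WQ _ Wx)).
  by move=> ->; rewrite /subgrid/= addn0; split.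
- move=> k; apply: (@negligibleS _ _ R mu _ _ _ (tree_cover tr (k0 + k))).
  move=> x [Qx nx]; split; first exact: (cell_sub_top tr PQ).
  move=> [W FW Wx]; apply: nx; exists W => //; split=> //.
  have kk : (k0 <= k0 + k)%N by exact: leq_addr.
  have [_ WA] := ancP tr FW kk.
  by rewrite -(anc_eq tr FW kk PQ Wx Qx).
- by move=> k W W' [FW _] [FW' _]; exact: (tree_disjoint tr FW FW').
- move=> k W [FW WQ]; rewrite addnS in FW.
  have [W' FW' WW'] := tree_nested tr FW; exists W' => //; split => //.
  have kk : (k0 <= k0 + k)%N by exact: leq_addr.
  have [x Wx] := cell_nonempty tr FW.
  have [_ WA] := ancP tr FW' kk.
  by rewrite -(anc_eq tr FW' kk PQ (WW' _ Wx) (WQ _ Wx)).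
- move=> k W W' [FW _] [FW' _] WW'; rewrite addnS in FW.
  exact: (tree_ratio tr FW FW' WW').
Qed.

End trees_of_grids.

Section restricted_lebesgue.
Variables (R : realType) (J : interval R).

Lemma leb_on_pt (x : R) : leb_on J [set x] = 0.
Proof.
rewrite /leb_on /= /mrestr; apply/eqP; rewrite eq_le measure_ge0 andbT.
rewrite -(lebesgue_measure_set1 x); apply: le_measure; rewrite ?inE//.
- by apply: measurableI; [exact: measurable_set1|exact: measurable_itv].
Qed.

Lemma leb_on_le1 : @lebesgue_measure R [set` J] = 1%:E ->
  (leb_on J setT <= 1)%E.
Proof. by move=> J1; rewrite /leb_on /= /mrestr setTI J1. Qed.

End restricted_lebesgue.

Section costs.
Variable R : realType.
Implicit Types (u : nat -> R) (q : \bar R).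

Lemma nneseries_ub u (x : \bar R) : (forall k, 0 <= u k) ->
  (forall n, ((\sum_(0 <= k < n) u k)%:E <= x)%E) ->
  (\sum_(0 <= k <oo) (u k)%:E <= x)%E.
Proof.
move=> u0 ux; apply: lime_le.
  by apply: is_cvg_nneseries => k _ _; rewrite lee_fin.
by apply: nearW => n; rewrite sumEFin.
Qed.

Lemma geom_sum_le (z : R) n : 0 <= z < 1 ->
  \sum_(0 <= k < n) z ^+ k <= (1 - z)^-1.
Proof.
move=> /andP[z0 z1]; have z1' : 0 < 1 - z by rewrite subr_gt0.
rewrite -[leRHS]mul1r ler_pdivlMr//.
suff -> : (\sum_(0 <= k < n) z ^+ k) * (1 - z) = 1 - z ^+ n.
  by rewrite lerBlDr lerDl exprn_ge0.
elim: n => [|n IH]; first by rewrite big_nil mul0r expr0 subrr.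
by rewrite big_nat_recr//= mulrDl IH exprS; ring.
Qed.

Definition seq_norm q u : \bar R :=
  match q with
  | r%:E => ((\sum_(0 <= k <oo) (u k `^ r)%:E) `^ r^-1)%E
  | +oo%E => ereal_sup (range (fun k => (u k)%:E))
  | -oo%E => 0%E
  end.

Lemma seq_norm_ge0 q u : (forall k, 0 <= u k) -> (0 <= seq_norm q u)%E.
Proof.
move=> u0; case: q => [r| |]//=; first exact: poweR_ge0.
apply: (@le_trans _ _ (u 0%N)%:E); first by rewrite lee_fin.
by apply: ereal_sup_ubound; exists 0%N.
Qed.

Lemma seq_norm_term q u k : (1 <= q)%E -> (forall k, 0 <= u k) ->
  ((u k)%:E <= seq_norm q u)%E.
Proof.
move=> q1 u0; case: q q1 => [r| |]//=; last first.
  by move=> _; apply: ereal_sup_ubound; exists k.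
rewrite lee_fin => r1; have r0 : 0 < r by rewrite (lt_le_trans _ r1).
rewrite -{1}[u k](@powR_Kroot _ r) ?gt_eqF// -poweR_EFin.
apply: gt0_ler_poweR; rewrite ?invr_ge0 ?(ltW r0)//.
- by rewrite in_itv/= lee_fin powR_ge0 leey.
- rewrite in_itv/= leey andbT nneseries_ge0// => j _ _.
  by rewrite lee_fin powR_ge0.
apply: le_trans (nneseries_lim_ge k.+1 _); last first.
  by move=> j _ _; rewrite lee_fin powR_ge0.
rewrite big_nat_recr//= leeDr// sume_ge0// => j _.
by rewrite lee_fin powR_ge0.
Qed.

Lemma seq_norm_conv q u v (K z : R) : (1 <= q)%E -> 0 <= K -> 0 <= z < 1 ->
  (forall k, 0 <= u k) -> (forall k, 0 <= v k) ->
  (forall j, v j <= K * ((1 - z) * geom_conv z u j)) ->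
  (seq_norm q v <= K%:E * seq_norm q u)%E.
Proof.
move=> q1 K0 z01 u0 v0 vu.
have /andP[z0 z1] := z01.
have gc0 j : 0 <= (1 - z) * geom_conv z u j.
  by rewrite mulr_ge0 ?geom_conv_ge0// subr_ge0 ltW.
case: q q1 => [r| |]//=; last first.
  move=> _; apply: ge_ereal_sup => _ [j _ <-].
  set B := ereal_sup _.
  have uB k : ((u k)%:E <= B)%E by apply: ereal_sup_ubound; exists k.
  (* If the supremum is infinite, the right-hand side is infinite for [K > 0]; for [K = 0] it is 0
     by convention, but then [v] vanishes too. *)
  have [Bfin|] := boolP (B \is a fin_num); last first.
    rewrite ge0_fin_numE; last by rewrite (le_trans _ (uB 0%N))// lee_fin.
    rewrite -leNgt leye_eq => /eqP ->.
    have [K_0|K_0] := eqVneq K 0.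
      by rewrite K_0 mul0e lee_fin (le_trans (vu j))// K_0 mul0r.
    by rewrite gt0_muley ?leey// lte_fin lt_neqAle eq_sym K_0.
  rewrite -(fineK Bfin) -EFinM lee_fin (le_trans (vu j))// ler_wpM2l//.
  by apply: geom_conv_bound => // k; rewrite u0 -lee_fin fineK//= uB.
rewrite lee_fin => r1; have r0 : 0 < r by rewrite (lt_le_trans _ r1).
have -> : K%:E = ((K `^ r)%:E `^ r^-1)%E.
  by rewrite poweR_EFin powR_Kroot// gt_eqF.
have su0 w : (0 <= \sum_(0 <= k <oo) (w k `^ r)%:E)%E.
  by apply: nneseries_ge0 => j _ _; rewrite lee_fin powR_ge0.
rewrite -poweRM ?su0 ?lee_fin ?powR_ge0//.
apply: gt0_ler_poweR; rewrite ?invr_ge0 ?(ltW r0)//.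
- by rewrite in_itv/= leey su0.
- by rewrite in_itv/= leey mule_ge0 ?su0 ?lee_fin ?powR_ge0.
apply: nneseries_ub => [k|n]; first exact: powR_ge0.
apply: (@le_trans _ _ ((K `^ r * \sum_(0 <= k < n) u k `^ r)%:E)).
  rewrite lee_fin.
  apply: (@le_trans _ _
    (K `^ r * \sum_(0 <= k < n) ((1 - z) * geom_conv z u k) `^ r)).
    rewrite mulr_sumr; apply: ler_sum => k _.
    by rewrite -powRM// ler_powR2l// ltW.
  by rewrite ler_wpM2l ?powR_ge0// geom_conv_powR.
rewrite EFinM lee_wpmul2l ?lee_fin ?powR_ge0// -sumEFin.
by apply: nneseries_lim_ge => j _ _; rewrite lee_fin powR_ge0.
Qed.

Lemma seq_norm_head q u : (1 <= q)%E -> (forall k, 0 <= u k) ->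
  (forall k, (0 < k)%N -> u k = 0) -> (seq_norm q u <= (u 0%N)%:E)%E.
Proof.
move=> q1 u0 uk; case: q q1 => [r| |]//=; last first.
  move=> _; apply: ge_ereal_sup => _ [[|j] _ <-]//.
  by rewrite uk// lee_fin.
rewrite lee_fin => r1; have r0 : 0 < r by rewrite (lt_le_trans _ r1).
rewrite -[u 0%N](@powR_Kroot _ r) ?gt_eqF// -poweR_EFin.
apply: gt0_ler_poweR; rewrite ?invr_ge0 ?(ltW r0)//.
- rewrite in_itv/= leey andbT nneseries_ge0// => j _ _.
  by rewrite lee_fin powR_ge0.
- by rewrite in_itv/= lee_fin powR_ge0 leey.
apply: nneseries_ub => [k|n]; first exact: powR_ge0.
rewrite lee_fin; case: n => [|n]; first by rewrite big_nil powR_ge0.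
rewrite big_nat_recl//= big1_seq ?addr0// => k _.
by rewrite uk// powR0// gt_eqF.
Qed.

(** The value of [limn] is informative only for a convergent series, so the geometric series is
    summed explicitly. *)
Lemma besov_Cb_gt0 (l2 b : R) q : 0 < l2 < 1 -> 0 < b -> (1 <= q)%E ->
  0 < besov_Cb l2 b q.
Proof.
move=> /andP[l20 l21] b0; case: q => [r| |]//=; rewrite lee_fin => r1.
have r0 : 0 < r by rewrite (lt_le_trans _ r1).
have z1 : l2 `^ (b * r) < 1.
  by rewrite powR_lt1 ?mulr_gt0// l20.
have -> : (fun k : nat => l2 `^ (k%:R * b * r)) = geometric 1 (l2 `^ (b * r)).
  apply/funext => k; rewrite /geometric/= mul1r -mulrA.
  rewrite (mulrC k%:R) (powRrM _ (b * r)).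
  by rewrite powR_mulrn// powR_ge0.
apply: powR_gt0.
have zn : `|l2 `^ (b * r)| < 1 by rewrite ger0_norm ?powR_ge0.
rewrite (cvg_lim _ (cvg_geometric_series zn))//.
by rewrite divr_gt0// subr_gt0.
Qed.

End costs.

(** * Representations by Souza atoms *)

Section representations.
Variable R : realType.
Notation T := (measurableTypeR R).
Variable mu : {measure set T -> \bar R}.
Variables (l1 l2 : R) (F : nat -> set (set T)) (top : set T).
Hypothesis tr : grid_tree mu l1 l2 F top.
Variable p : R.
Hypothesis p1 : 1 <= p.
Local Notation sz := (msize mu).

Let p0 : 0 < p. Proof. by rewrite (lt_le_trans _ p1). Qed.

Lemma rep_costE q c : rep_cost F p q c = seq_norm q (level_norm F p c).
Proof.
rewrite /rep_cost /seq_norm /level_norm; case: q => [r| |]//.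
  congr (_ `^ _)%E; apply: eq_eseriesr => k _.
  by rewrite (fsum_cells tr) mulrC powRrM.
by under eq_fun do rewrite (fsum_cells tr).
Qed.

Lemma level_norm_ge0 c k : 0 <= level_norm F p c k.
Proof. exact: powR_ge0. Qed.

(** A uniform bound [B] on the convolution is assumed in place of [s < b], so as to cover an atom
    with [s = b] as well as representations of finite cost. *)
Lemma flat_is_rep (s b B : R) c a (g : T -> R[i]) : 0 < s -> s <= b ->
  b <= p^-1 -> (forall k Q, F k Q -> bv_cell mu p s b Q (a Q)) ->
  (forall j, geom_conv (l2 `^ (b - s)) (level_norm F p c) j <= B) ->
  cmeasurable g ->
  (cLnorm mu p%:E (fun x => g x - layer_sum F c a n x)%R
     @[n --> \oo] --> 0%E) ->
  is_rep mu F (souza_atom mu s p) p g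
    (flat_coef mu F p s (layer_sum F c a)) (flat_atom mu p s).
Proof.
move=> s0 sb bp bva HB mg gc.
have b0 : 0 < b by exact: lt_le_trans sb.
have [_ lay rem] := flat_expansion tr p1 s0 sb bp c bva.
have /andP[l20 l21] := tree_l2_itv tr.
set t := flat_coef _ _ _ _ _ in lay rem *.
set e := flat_atom _ _ _ in lay rem *.
set rho := l2 `^ s in lay rem.
have rho01 : 0 <= rho < 1.
  by rewrite powR_ge0 powR_lt1// l20.
have /andP[rho0 rho1] := rho01.
have C0 : 0 <= 3 + l1^-1.
  by rewrite addr_ge0// invr_ge0 ltW// (tree_l1_gt0 tr).
pose D := (3 + l1^-1) * B.
have boundD j : rho ^+ j *
    ((3 + l1^-1) * geom_conv (l2 `^ (b - s)) (level_norm F p c) j)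
    <= rho ^+ j * D.
  by rewrite ler_wpM2l ?exprn_ge0// ler_wpM2l.
have B0 : 0 <= B.
  rewrite (le_trans _ (HB 0%N))// geom_conv_ge0 ?powR_ge0// => k.
  exact: level_norm_ge0.
have D0 : 0 <= D by rewrite mulr_ge0.
have ma k Q : F k Q -> cmeasurable (a Q).
  move=> FQ; have [ao _ v] := bva _ _ FQ.
  exact: var_bounded_measurable b0 (tree_itv tr FQ) ao v.
have me k Q : F k Q -> cmeasurable (e Q) by exact: (cmeasurable_flat_atom tr).
split.
- by move=> k Q FQ; exact: (flat_atom_souza mu p s FQ).
- apply: (@le_lt_trans _ _ (\sum_(0 <= k <oo) (rho ^+ k * D)%:E)%E).
    apply: lee_nneseries => [k _ _|k _]; first exact: Lnorm_ge0.
    by apply: (le_trans (lay k)); rewrite lee_fin.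
  apply: (@le_lt_trans _ _ ((1 - rho)^-1 * D)%:E); last exact: ltry.
  apply: nneseries_ub => [k|n]; first by rewrite mulr_ge0// exprn_ge0.
  by rewrite lee_fin -mulr_suml ler_wpM2r// geom_sum_le.
(* The remainder bound concerns [n.+1] layers, so the sequence is shifted by one and then squeezed,
   through g - S and S minus the new partial sum. *)
rewrite -(cvg_shiftS (fun n => cLnorm mu p%:E
  (fun x => g x - \sum_(0 <= k < n) layer F t e k x)%R)).
have upper : (cLnorm mu p%:E (fun x => g x - layer_sum F c a n.+1 x)%R +
    (rho ^+ n * D)%:E)%E @[n --> \oo] --> 0%E.
  rewrite -[X in _ --> X]adde0; apply: cvgeD => //.
    by rewrite (cvg_shiftS (fun n => cLnorm mu p%:E
      (fun x => g x - layer_sum F c a n x)%R)).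
  apply/cvg_EFin; first by apply: nearW.
  rewrite -[X in _ --> X](mul0r D); apply: cvgMl.
  have := @cvg_geometric R 1 rho; rewrite ger0_norm// => /(_ rho1).
  by rewrite /geometric; under eq_fun do rewrite mul1r.
apply: (squeeze_cvge _ (cvg_cst 0%E) upper); apply: nearW => n.
rewrite Lnorm_ge0/=.
have mS := cmeasurable_layer_sum tr c n.+1 ma.
have mt := cmeasurable_layer_sum tr t n.+1 me.
have := cLnormD mu p1 (cmeasurableB mg mS) (cmeasurableB mS mt).
under eq_fun do rewrite addrA subrK.
move=> /le_trans; apply; rewrite leeD2l//.
by apply: (le_trans (rem n)); rewrite lee_fin.
Qed.

(** The smoothness enters [bv_cell] only through the normalization; the variation exponent [b] is
    unchanged. An atom of smoothness [s] can thus be expanded in a space of smoothness [beta]. *)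
Lemma bv_cell_scale (s b beta : R) Q f : 0 < b -> 0 < sz Q ->
  bv_cell mu p s b Q f ->
  bv_cell mu p beta b Q (fun x => ((sz Q `^ (beta - s))%:C)%C * f x).
Proof.
move=> b0 q0 [fo fb fv].
have k0 : 0 <= sz Q `^ (beta - s) by exact: powR_ge0.
have mE u v : sz Q `^ u * sz Q `^ v = sz Q `^ (u + v).
  by rewrite -powRD// (gt_eqF q0) implybT.
split.
- by move=> x /fo ->; rewrite mulr0.
- move=> x /fb fx; rewrite cabsM cabs_real ger0_norm//.
  rewrite (le_trans (ler_wpM2l k0 fx))// mulrCA mE.
  by rewrite (_ : _ + _ = beta - p^-1)//; ring.
- move=> xs xs1 xs2; have := fv xs xs1 xs2.
  have -> : var_sum b (fun x => ((sz Q `^ (beta - s))%:C)%C * f x) xs =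
      (sz Q `^ (beta - s)) `^ b^-1 * var_sum b f xs.
    rewrite /var_sum mulr_sumr; apply: eq_bigr => i _.
    by rewrite -mulrBr cabsM cabs_real ger0_norm// powRM// cabs_ge0.
  move=> h; rewrite (le_trans (ler_wpM2l (powR_ge0 _ _) h))//.
  rewrite -powRrM mE (_ : _ + _ = (beta - p^-1) / b)//.
  by field; rewrite !gt_eqF.
Qed.

Lemma bv_cell0 (s b : R) Q : b != 0 -> bv_cell mu p s b Q (fun=> 0).
Proof.
move=> b0; split=> // [x _|xs _ _]; first by rewrite cabs0 mulr_ge0// powR_ge0.
rewrite /var_sum big1 ?powR_ge0// => i _.
by rewrite subrr cabs0 powR0// invr_eq0.
Qed.

(** The atom is a representation with one term, on the top cell, and level norms [ga], 0, 0, ...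
    Their convolution is [ga] z^j with z = l2^(b - beta): it is in l^q when z < 1 and only bounded
    when z = 1, hence the link between [b = beta] and [q = +oo]. *)
Lemma single_atom (s b beta : R) f (g : R) q : 0 < beta -> beta <= b ->
  b <= p^-1 -> (1 <= q)%E -> (b = beta -> q = +oo%E) -> 0 <= g ->
  bv_cell mu p s b top f ->
  let K := if b == beta then 3 + l1^-1
           else (3 + l1^-1) / (1 - l2 `^ (b - beta)) in
  let h := fun x => (g%:C)%C * f x in
  besov mu F (souza_atom mu beta p) p q h /\
  (besov_norm mu F (souza_atom mu beta p) p q h <=
    (K * (g * sz top `^ (s - beta)))%:E)%E.
Proof.
move=> beta0 bb bp q1 qoo g0 bvf K h.
have b0 : 0 < b by exact: lt_le_trans bb.
have topF := top_cell tr.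
have q0 := sz_gt0 tr topF.
pose ga := g * sz top `^ (s - beta).
have ga0 : 0 <= ga by rewrite mulr_ge0 ?powR_ge0.
pose c Q : R[i] := if Q == top then (ga%:C)%C else 0.
pose a Q : T -> R[i] := if Q == top then
  fun x => ((sz top `^ (beta - s))%:C)%C * f x else fun=> 0.
have bva k Q : F k Q -> bv_cell mu p beta b Q (a Q).
  move=> FQ; rewrite /a; case: eqVneq => [->|_]; first exact: bv_cell_scale.
  by apply: bv_cell0; rewrite gt_eqF.
have A_0 : level_norm F p c 0%N = ga.
  rewrite /level_norm (bigD1_seq top) ?cells_uniq//=; last exact/(cellsP tr).
  rewrite big1_seq => [|Q /andP[QN _]]; last first.
    by rewrite /c (negPf QN) cabs0 powR0// gt_eqF.
  by rewrite /c eqxx addr0 cabs_real ger0_norm// powR_Kroot// gt_eqF.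
have A_S k : (0 < k)%N -> level_norm F p c k = 0.
  move=> k0; rewrite /level_norm big1_seq => [|Q /andP[_ /(cellsP tr) FQ]].
    by rewrite powR0// invr_eq0 gt_eqF.
  have QN : Q != top.
    apply/eqP => Qt; rewrite Qt in FQ.
    by have k00 := level_unique tr FQ topF; rewrite k00 in k0.
  by rewrite /c (negPf QN) cabs0 powR0// gt_eqF.
(* All partial sums but the empty one equal [h], so after a shift the convergence is that of a
   constant sequence. *)
have hE n x : layer_sum F c a n.+1 x = h x.
  rewrite /layer_sum big_nat_recl//= [X in _ + X]big1 ?addr0 => [|k _].
    rewrite /layer (fsum_cells tr) (bigD1_seq top) ?cells_uniq//=; last first.
      exact/(cellsP tr).
    rewrite big1_seq ?addr0 => [|Q /andP[QN _]]; last first.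
      by rewrite /c (negPf QN) mul0r.
    rewrite /c /a eqxx /h mulrA -rmorphM/=; congr ((_%:C)%C * _).
    rewrite -mulrA -powRD; last by rewrite (gt_eqF q0) implybT.
    by rewrite addrA subrK subrr powRr0 mulr1.
  rewrite /layer (fsum_cells tr) big1_seq// => Q /andP[_ /(cellsP tr) FQ].
  have QN : Q != top.
    by apply/eqP => Qt; rewrite Qt in FQ; have := level_unique tr FQ topF.
  by rewrite /c (negPf QN) mul0r.
have mh : cmeasurable h.
  have [fo _ fv] := bvf; apply: cmeasurableZ.
  exact: var_bounded_measurable b0 (tree_itv tr topF) fo fv.
set z := l2 `^ (b - beta).
have /andP[l20 l21] := tree_l2_itv tr.
have z01 : 0 <= z <= 1.
  rewrite powR_ge0/= /z -[leRHS](powRr0 l2) ger_powR ?subr_ge0//.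
  by rewrite l20 ltW.
have /andP[z0 z1] := z01.
have conv_le j : geom_conv z (level_norm F p c) j <= ga.
  elim: j => [|j IH]; first by rewrite geom_conv0 A_0.
  rewrite geom_convS A_S// addr0 (le_trans _ IH)// ler_piMl// geom_conv_ge0//.
  by move=> k; exact: level_norm_ge0.
have C0 : 0 <= 3 + l1^-1.
  by rewrite addr_ge0// invr_ge0 ltW// (tree_l1_gt0 tr).
have rep := @flat_is_rep beta b ga c a h beta0 bb bp bva conv_le mh.
have {}rep : is_rep mu F (souza_atom mu beta p) p h
    (flat_coef mu F p beta (layer_sum F c a)) (flat_atom mu p beta).
  apply: rep; rewrite -(cvg_shiftS (fun n => cLnorm mu p%:E
    (fun x => h x - layer_sum F c a n x)%R)).
  rewrite (_ : (fun n => _) = cst 0%E); first exact: cvg_cst.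
  apply/funext => n; rewrite /cLnorm.
  under eq_Lnorm do rewrite hE subrr cabs0.
  by apply: Lnorm0; rewrite eqe gt_eqF.
have cost : (rep_cost F p q (flat_coef mu F p beta (layer_sum F c a)) <=
    (K * ga)%:E)%E.
  have [lev _ _] := flat_expansion tr p1 beta0 bb bp c bva.
  rewrite rep_costE /K; case: eqVneq => [bE|bN].
    rewrite (qoo bE)/=; apply: ge_ereal_sup => _ [j _ <-].
    by rewrite lee_fin (le_trans (lev j))// ler_wpM2l.
  have z1' : z < 1.
    have bbl : 0 < b - beta by rewrite subr_gt0 lt_neqAle eq_sym bN.
    by rewrite powR_lt1// l20.
  have zz : 0 < 1 - z by rewrite subr_gt0.
  apply: (@le_trans _ _ (((3 + l1^-1) / (1 - z))%:E *
      seq_norm q (level_norm F p c))%E).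
    apply: (@seq_norm_conv _ q _ _ _ z) => //.
    - by rewrite divr_ge0// ltW.
    - by rewrite z0.
    - by move=> k; exact: level_norm_ge0.
    - by move=> k; exact: level_norm_ge0.
    - by move=> j; rewrite mulrA divfK ?gt_eqF// lev.
  rewrite [in leRHS]EFinM lee_wpmul2l ?lee_fin ?divr_ge0 ?(ltW zz)//.
  rewrite -A_0; apply: seq_norm_head => // k; exact: level_norm_ge0.
have cost_fin := le_lt_trans cost (ltry _).
split.
  split; last by exists (flat_coef mu F p beta (layer_sum F c a)),
    (flat_atom mu p beta).
  split; [exact: (proj1 mh)|exact: (proj2 mh)|].
  have [fo fb _] := bvf.
  apply: le_lt_trans (ltry _); apply: (@cLnorm_le_step _ _ _ _ _ _ tr _ p1 0 h
    (fun W => g * (2 * sz top `^ (s - p^-1)))) => //.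
  - by move=> W; rewrite !mulr_ge0// powR_ge0.
  - move=> W x; rewrite (tree_top tr) => -> Wx.
    by rewrite /h cabsM cabs_real ger0_norm// ler_wpM2l// fb.
  - by move=> x /fo fx; rewrite /h fx mulr0.
apply: le_trans cost; apply: ereal_inf_lbound.
by exists (flat_coef mu F p beta (layer_sum F c a)), (flat_atom mu p beta).
Qed.

End representations.

(** * Bounded variation atoms *)

Section bounded_variation_atoms.
Variable R : realType.
Notation T := (measurableTypeR R).
Variable mu : {measure set T -> \bar R}.
Variables (l1 l2 : R) (F : nat -> set (set T)) (top : set T).
Hypothesis tr : grid_tree mu l1 l2 F top.
Variable p : R.
Hypothesis p1 : 1 <= p.
Local Notation sz := (msize mu).

(** At exponent [+oo], [Lnorm] unfolds to the essential supremum under the condition that the total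
    mass is positive. *)
Lemma tree_measure_gt0 : (0 < mu setT)%E.
Proof.
have topF := top_cell tr; apply: lt_le_trans (tree_pos tr topF) _.
by apply: le_measure; rewrite ?inE//; exact: (tree_measurable tr topF).
Qed.

(** The essential bound holds at some interior point [x0], since the interior is not null. Chains of
    two points bound the distance from [f x0] to any other interior value by the same constant,
    whence the factor two. *)
Lemma bv_atom_cell (s b : R) k Q f : 0 < b -> F k Q ->
  bv_atom mu s b p Q f -> bv_cell mu p s b Q f.
Proof.
move=> b0 FQ [fo fsup fvar].
set M := sz Q `^ (s - p^-1) in fsup fvar *.
have M0 : 0 <= M by exact: powR_ge0.
have fv : var_bounded b f Q (sz Q `^ ((s - p^-1) / b)).
  move=> xs xs1 xs2; rewrite powRrM -/M.
  rewrite (@ler_powR_root _ b) ?powR_ge0 ?var_sum_ge0 ?powR_rootK ?gt_eqF//.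
  rewrite -lee_fin (le_trans _ fvar)//; apply: ereal_sup_ubound.
  by exists xs.
have [x0 [Qx0 fx0]] : exists x0, interior (Q : set R) x0 /\ cabs (f x0) <= M.
  apply: contrapT => nox.
  have sup_le : (ess_sup mu (abse \o (fun x => (cabs (f x))%:E)) <= M%:E)%E.
    by move: fsup; rewrite /cLnorm unlock /= tree_measure_gt0.
  have /ess_supP ae_le := sup_le.
  have negQ := negligibleU (boundary_negligible tr FQ) ae_le.
  have : mu.-negligible Q.
    apply: (@negligibleS _ _ R mu _ _ _ negQ) => x Qx.
    have [iQx|NiQx] := pselect (interior (Q : set R) x); last by left.
    right => /=; rewrite lee_fin ger0_norm ?cabs_ge0// => fx.
    by apply: nox; exists x.
  move/(measure_negligible (tree_measurable tr FQ)) => Q0.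
  by have := tree_pos tr FQ; rewrite Q0 ltxx.
split=> // x Qx; rewrite mulr2n mulrDl !mul1r.
rewrite -[f x](subrK (f x0)) (le_trans (cabsD _ _))// lerD//.
have step u v : interior (Q : set R) u -> interior (Q : set R) v -> u < v ->
    cabs (f v - f u) <= M.
  move=> Qu Qv uv.
  have := fv [:: u; v]; rewrite /= uv => /(_ isT) h.
  have {}h : var_sum b f [:: u; v] <= sz Q `^ ((s - p^-1) / b).
    by apply: h => w; rewrite !inE => /orP[] /eqP ->.
  move: h; rewrite /var_sum/= big_nat1/= powRrM -/M => h.
  rewrite (@ler_powR_root _ b^-1) ?invr_gt0 ?cabs_ge0//.
have [xx0|xx0|->] := ltgtP x x0.
- by rewrite -cabsN opprB step.
- exact: step.
- by rewrite subrr cabs0.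
Qed.

Lemma souza_bv_atom (s b : R) k Q f : 0 < b -> F k Q ->
  souza_atom mu s p Q f -> bv_atom mu s b p Q f.
Proof.
move=> b0 FQ [[z fz] fo fb]; split => //.
  rewrite /cLnorm unlock /= tree_measure_gt0.
  apply/ess_supP; apply: aeW => x /=.
  by rewrite lee_fin ger0_norm ?cabs_ge0.
apply: ge_ereal_sup => _ [xs [xs1 xs2 ->]].
rewrite lee_fin big1_seq ?powR0 ?powR_ge0 ?gt_eqF// => i.
rewrite mem_index_iota => /andP[_ /andP[_ ixs]].
have mem j : (j < size xs)%N -> f xs`_j = z.
  move=> jxs; have xj : (xs`_j : R) \in xs by exact: mem_nth.
  apply: fz; apply: interior_subset; apply: xs2; exact: xj.
have i1 : (i.+1 < size xs)%N by rewrite -ltn_predRL.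
by rewrite (mem _ i1) (mem _ (ltnW i1)) subrr cabs0 powR0// invr_eq0 gt_eqF.
Qed.

(** Souza atoms have zero variation, so their representations serve unchanged, with constant 1. In
    the other direction the representation is resampled, and [s < b] makes the ratio [z] less than
    one. *)
Lemma besov_equiv_bv (s b : R) q : 0 < s -> s < b -> b <= p^-1 ->
  (1 <= q)%E ->
  besov_equiv mu F (souza_atom mu s p) (bv_atom mu s b p) p q.
Proof.
move=> s0 sb bp q1.
have p0 : 0 < p by rewrite (lt_le_trans _ p1).
have b0 : 0 < b by exact: lt_trans sb.
set z := l2 `^ (b - s).
have /andP[l20 l21] := tree_l2_itv tr.
have z01 : 0 <= z < 1.
  rewrite powR_ge0/=; have bs : 0 < b - s by rewrite subr_gt0.
  by rewrite powR_lt1// l20.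
have /andP[z0 z1] := z01.
have zz : 0 < 1 - z by rewrite subr_gt0.
have C0 : 0 < 3 + l1^-1 by rewrite addr_gt0// invr_gt0 (tree_l1_gt0 tr).
pose K := (3 + l1^-1) / (1 - z).
have K0 : 0 < K by rewrite divr_gt0.
have Kfin (x : \bar R) : (x < +oo)%E -> (K%:E * x < +oo)%E.
  by apply: lte_mul_pinfty => //; rewrite lee_fin ltW.
have to_bv g c a : is_rep mu F (souza_atom mu s p) p g c a ->
    is_rep mu F (bv_atom mu s b p) p g c a.
  move=> [ha hs hc]; split => // k Q FQ.
  exact: souza_bv_atom b0 FQ (ha _ _ FQ).
have to_souza g c a : cmeasurable g ->
    is_rep mu F (bv_atom mu s b p) p g c a -> (rep_cost F p q c < +oo)%E ->
    exists t e, is_rep mu F (souza_atom mu s p) p g t e /\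
      (rep_cost F p q t <= K%:E * rep_cost F p q c)%E.
  move=> mg [ha hs hc] cfin.
  have bva k Q : F k Q -> bv_cell mu p s b Q (a Q).
    by move=> FQ; exact: bv_atom_cell b0 FQ (ha _ _ FQ).
  exists (flat_coef mu F p s (layer_sum F c a)), (flat_atom mu p s).
  rewrite !(rep_costE tr); rewrite (rep_costE tr) in cfin.
  have A0 := level_norm_ge0 F p c.
  have sfin : seq_norm q (level_norm F p c) \is a fin_num.
    by rewrite ge0_fin_numE// seq_norm_ge0.
  have AB k : 0 <= level_norm F p c k <= fine (seq_norm q (level_norm F p c)).
    by rewrite A0 -lee_fin fineK// seq_norm_term.
  have [lev _ _] := flat_expansion tr p1 s0 (ltW sb) bp c bva.
  split.
    apply: (flat_is_rep tr p1
      (B := fine (seq_norm q (level_norm F p c)) / (1 - z)))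
      s0 (ltW sb) bp bva _ mg hc => j.
    by rewrite ler_pdivlMr// mulrC; exact: geom_conv_bound.
  apply: (seq_norm_conv q1 (ltW K0) z01 A0 (level_norm_ge0 F p _)) => j.
  by rewrite mulrA divfK ?gt_eqF// lev.
(* With [K^-1] on the smaller side, the right-hand infimum can be treated one representation at a
   time. *)
have norm_le g : cmeasurable g ->
    (K^-1%:E * besov_norm mu F (souza_atom mu s p) p q g <=
      besov_norm mu F (bv_atom mu s b p) p q g)%E.
  move=> mg; apply: le_ereal_inf_tmp => _ [c [a [rep cfin ->]]].
  have [t [e [rep' cost']]] := to_souza g c a mg rep cfin.
  rewrite lee_pdivrMl//; apply: (le_trans _ cost'); apply: ereal_inf_lbound.
  exists t, e; split; [exact: rep'| |reflexivity].
  exact: (le_lt_trans cost' (Kfin _ cfin)).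
split.
  apply/seteqP; split=> g [gLp [c [a [rep cfin]]]]; split; try exact: gLp.
    by exists c, a; split; [exact: to_bv|].
  have mg : cmeasurable g by case: gLp.
  have [t [e [rep' cost']]] := to_souza g c a mg rep cfin.
  exists t, e; split; first exact: rep'.
  exact: (le_lt_trans cost' (Kfin _ cfin)).
exists K^-1, 1; split; rewrite ?invr_gt0// => g [gLp _]; split.
  by apply: norm_le; case: gLp.
rewrite mul1e; apply: ereal_inf_le_tmp => _ [c [a [rep cfin ->]]].
by exists c, a; split; [exact: to_bv| |].
Qed.

End bounded_variation_atoms.

(** * Inclusions between the sets of atoms, and the theorem *)

Section scaled_atoms.
Variables (R : realType) (mu : {measure set (measurableTypeR R) -> \bar R}).
Variables (l1 l2 p : R) (P : nat -> set (set (measurableTypeR R))).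
Variable top : set (measurableTypeR R).
Hypothesis tr : grid_tree mu l1 l2 P top.
Hypothesis p1 : 1 <= p.

Lemma scaled_bv_besov_atom (s beta b : R) q : 0 < s -> s <= beta ->
  beta <= b -> b <= p^-1 -> (1 <= q)%E -> (b = beta -> q = +oo%E) ->
  exists2 c0 : R, 0 < c0 & forall k Q, P k Q ->
    scale_set c0 (bv_atom mu s b p Q) `<=` besov_atom mu P l2 s beta p q k Q.
Proof.
move=> s0 sb bb bp q1 qoo.
have beta0 : 0 < beta by exact: lt_le_trans sb.
have b0 : 0 < b by exact: lt_le_trans bb.
have /andP[l20 l21] := tree_l2_itv tr.
have Cb0 : 0 < besov_Cb l2 beta q by apply: besov_Cb_gt0 => //; rewrite l20.
pose K := if b == beta then 3 + l1^-1
          else (3 + l1^-1) / (1 - l2 `^ (b - beta)).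
have C0 : 0 < 3 + l1^-1 by rewrite addr_gt0// invr_gt0 (tree_l1_gt0 tr).
have K0 : 0 < K.
  rewrite /K; case: eqVneq => // bN; rewrite divr_gt0// subr_gt0.
  have bbl : 0 < b - beta by rewrite subr_gt0 lt_neqAle eq_sym bN.
  by rewrite powR_lt1// l20.
(* [K] is the loss in [single_atom]; [besov_Cb] is the normalization demanded by [besov_atom]. *)
exists (K * besov_Cb l2 beta q)^-1; first by rewrite invr_gt0 mulr_gt0.
move=> k Q PQ _ [f fbv <-].
have trQ := subgrid_tree tr PQ.
have fc := bv_atom_cell tr b0 PQ fbv.
have c00 : 0 <= (K * besov_Cb l2 beta q)^-1.
  by rewrite invr_ge0 mulr_ge0// ltW.
have [hb hn] := single_atom trQ p1 beta0 bb bp q1 qoo c00 fc.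
split=> //.
  by case: fc => fo _ _ x /fo ->; rewrite mulr0.
apply: (le_trans hn); rewrite lee_fin -/K mulrA invfM mulrA divff ?gt_eqF//.
by rewrite mul1r mulrC.
Qed.

End scaled_atoms.

(** The equivalence for the exponent [b] is stated with [s < b]: at [s = b] the ratio l2^(b-s) is 1
    and the convolution is no longer bounded on l^q. *)
Theorem proposition16p3 (R : realType) (J : interval R) (l1 l2 p : R)
    (P : nat -> set (set (measurableTypeR R)))
    (J1 : @lebesgue_measure R [set` J] = 1%:E)
    (Pgrid : good_grid (leb_on J) [set` J] l1 l2 P)
    (Pitv : forall k Q, P k Q -> is_interval (Q : set R))
    (p1 : 1 <= p) :
  [/\ (forall s b : R, 0 < s -> s <= b -> b <= p^-1 ->
        exists2 c1 : R, 0 < c1 & forall k Q, P k Q ->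
          scale_set c1 (bv_atom (leb_on J) s b p Q)
            `<=` besov_atom (leb_on J) P l2 s b p +oo%E k Q),
      (forall s b b' : R, 0 < s -> s <= b -> b < b' -> b' <= p^-1 ->
        forall q : \bar R, (1 <= q)%E ->
        exists2 c2 : R, 0 < c2 & forall k Q, P k Q ->
          scale_set c2 (bv_atom (leb_on J) s b' p Q)
            `<=` besov_atom (leb_on J) P l2 s b p q k Q),
      (forall s b : R, 0 < s -> s < b -> b <= p^-1 ->
        forall q : \bar R, (1 <= q)%E ->
          besov_equiv (leb_on J) P
            (souza_atom (leb_on J) s p) (bv_atom (leb_on J) s b p) p q) &
      (forall s b b' : R, 0 < s -> s <= b -> b < b' -> b' <= p^-1 ->
        forall q : \bar R, (1 <= q)%E ->
          besov_equiv (leb_on J) P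
            (souza_atom (leb_on J) s p) (bv_atom (leb_on J) s b' p) p q)].
Proof.
have tr := good_grid_tree (leb_on_pt J) (leb_on_le1 J1) Pitv Pgrid.
split.
- move=> s b s0 sb bp.
  by apply: (scaled_bv_besov_atom tr p1 s0 sb (lexx b) bp); rewrite ?leey.
- move=> s b b' s0 sb bb' bp q q1.
  apply: (scaled_bv_besov_atom tr p1 s0 sb (ltW bb') bp q1) => bE.
  by rewrite bE ltxx in bb'.
- by move=> s b s0 sb bp q q1; exact: (besov_equiv_bv tr p1 s0 sb bp q1).
- move=> s b b' s0 sb bb' bp q q1.
  exact: (besov_equiv_bv tr p1 s0 (le_lt_trans sb bb') bp q1).
Qed.
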